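(* Let $R$ be a Hecke symmetry of $GL_N$ type (an $N^2\times N^2$ complex matrix), that is, a skew-invertible Hecke symmetry whose $R$-skew-symmetrizers satisfy $\dim\operatorname{Im}A^{(N)}=1$ and $A^{(N+1)}=0$. Let $M=\|m_i^j\|$ and $D=\|\partial_i^j\|$ be the generating matrices of the algebras $\mathcal{M}(R)$ and $\mathcal{D}(R^{-1})$ in the quantum double, i.e. of the unital associative algebra generated by the $m_i^j,\partial_i^j$ subject to $$R\,M_1R\,M_1=M_1R\,M_1R,\qquad R^{-1}D_1R^{-1}D_1=D_1R^{-1}D_1R^{-1},\qquad D_1R\,M_1=R\,M_1R^{-1}D_1R^{-1}+I,$$ and let $L=MD$. Then $$\langle A^{(N)}L_{\overline 1}(L_{\overline 2}+qI)\cdots(L_{\overline N}+q^{N-1}(N-1)_qI)\rangle_{1\dots N}=q^{-N}\,{\det}_RM\;{\det}_{R^{-1}}D,$$ where the $j$-th factor after $A^{(N)}$ on the left-hand side ($1\le j\le N$) is $L_{\overline j}+q^{j-1}(j-1)_qI$.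
   Context: Ground field $\mathbb{C}$; $N\ge1$. $R$ is a numerical $N^2\times N^2$ matrix acting on $V\otimes V$, $V=\mathbb{C}^N$. It is a braiding if it is a solution of $R_{12}R_{23}R_{12}=R_{23}R_{12}R_{23}$, where $R_{12}=R\otimes I$, $R_{23}=I\otimes R$. It is a Hecke symmetry if it is a braiding and $(qI\otimes I-R)(q^{-1}I\otimes I+R)=0$ with $q\in\mathbb{C}$, $q\notin\{0,\pm1\}$ (so $R$ is invertible). It is skew-invertible if there is an $N^2\times N^2$ matrix $\Psi$ with $\mathrm{Tr}_{(2)}R_{12}\Psi_{23}=\mathrm{Tr}_{(2)}\Psi_{12}R_{23}=P_{13}$, where $P$ is the flip and $\mathrm{Tr}_{(2)}$ is the usual trace over the second tensor factor. $R$-trace (quantum trace): with the $N\times N$ matrix $C=\mathrm{Tr}_{(2)}\Psi_{12}$, put $\mathrm{Tr}_RX=\mathrm{Tr}(CX)$ for an $N\times N$ matrix $X$ (equivalently, normalized so that $\mathrm{Tr}_{R(2)}R_{12}=I_1$). For an $N^k\times N^k$ matrix $X$, $\langle X\rangle_{1\dots k}=\mathrm{Tr}_{R(1)}\cdots\mathrm{Tr}_{R(k)}X=\mathrm{Tr}_{(1\dots k)}(C_1\cdots C_kX)$, where $C_i$ is $C$ acting in the $i$-th tensor factor. $q$-integers: $k_q=\dfrac{q^k-q^{-k}}{q-q^{-1}}$; it is assumed that $k_q\neq0$ for all $k\ge1$. For a matrix $X=\|x_i^j\|_{1\le i,j\le N}$ ($i$ is the row index, $j$ the column index) with entries in a possibly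 noncommutative algebra, $X_1=X\otimes I$; products of matrices are usual matrix products with the order of the entries preserved, so $L=MD$ has entries $l_i^j=\sum_k m_i^k\partial_k^j$. In the relation between $D$ and $M$ the symbol $I$ is the identity on $V\otimes V$. $\mathcal{M}(R)$ is the unital associative algebra generated by the $m_i^j$ with the first of the displayed relations; $\mathcal{D}(R^{-1})$ is the one generated by the $\partial_i^j$ with the second; the third relation is the permutation relation of the quantum double. On $V^{\otimes k}$ put $R_i=I^{\otimes(i-1)}\otimes R\otimes I^{\otimes(k-i-1)}$. For $X=M,D,L$ (the first copy acting in the first tensor factor) the copies are $X_{\overline 1}=X_1$, $X_{\overline{i+1}}=R_iX_{\overline i}R_i^{-1}$. In the identity of the claim $I$ is the identity on $V^{\otimes N}$. The $R$-skew-symmetrizers $A^{(k)}$ acting on $V^{\otimes k}$ are defined by $A^{(1)}=I$ and, for $k\ge2$, $$A^{(k)}_{1\dots k}=\frac1{k_q}A^{(k-1)}_{1\dots k-1}\big(q^{k-1}I^{\otimes k}-(k-1)_qR_{k-1}\big)A^{(k-1)}_{1\dots k-1},$$ where the subscript $1\dots k-1$ means acting in the first $k-1$ tensor factors. Quantum determinants: $${\det}_RM=q^{N^2}\langle A^{(N)}M_{\overline 1}M_{\overline 2}\cdots M_{\overline N}\rangle_{1\dots N},\qquad {\det}_{R^{-1}}D=q^{N^2}\langle A^{(N)}D_{\overline N}\cdots D_{\overline 1}\rangle_{1\dots N}.$$ *)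

(* Defs.v *)
(* Tensor factors are numbered from 0. *)
From HB Require Import structures.
From mathcomp Require Import all_boot all_order all_algebra.
From mathcomp Require Import boolp reals.
From mathcomp.real_closed Require Import complex.
From mathcomp.multinomials Require Import monalg.

Set Implicit Arguments.
Unset Strict Implicit.
Unset Printing Implicit Defensive.
Import GRing.Theory.
Local Open Scope ring_scope.
Local Open Scope quotient_scope.

Section TwoSidedQuotient.
Variables (B : nzRingType) (S : B -> Prop).

(* The two-sided ideal generated by S. *)
Inductive tsideal : B -> Prop :=
| tsideal0 : tsideal 0
| tsidealD x a s b : tsideal x -> S s -> tsideal (x + a * s * b).

Lemma tsideal_add x y : tsideal x -> tsideal y -> tsideal (x + y).
Proof.
move=> Ix; elim=> [|z a s b _ IH Ss]; first by rewrite addr0.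
by rewrite addrA; apply: tsidealD.
Qed.

Lemma tsideal_mul c d x : tsideal x -> tsideal (c * x * d).
Proof.
elim=> [|z a s b _ IH Ss]; first by rewrite mulr0 mul0r; constructor.
have -> : c * (z + a * s * b) * d = c * z * d + (c * a) * s * (b * d).
  by rewrite mulrDr mulrDl !mulrA.
exact: tsidealD.
Qed.

Lemma tsideal_opp x : tsideal x -> tsideal (- x).
Proof. by move/(tsideal_mul (-1) 1); rewrite mulr1 mulN1r. Qed.

Lemma tsideal_gen s : S s -> tsideal s.
Proof.
by move=> Ss; have := tsidealD 1 1 tsideal0 Ss; rewrite add0r mul1r mulr1.
Qed.

Definition ts_equiv (x y : B) : bool := `[< tsideal (x - y) >].

Lemma ts_equiv_is_equiv : equiv_class_of ts_equiv.
Proof.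
split=> [x|x y|y x z].
- by apply/asboolP; rewrite subrr; constructor.
- by apply/asboolP/asboolP=> /tsideal_opp; rewrite opprB.
- move=> /asboolP Hxy /asboolP Hyz; apply/asboolP.
  by have := tsideal_add Hxy Hyz; rewrite addrA subrK.
Qed.

Canonical ts_equiv_equiv := EquivRelPack ts_equiv_is_equiv.

Definition tsquot := {eq_quot ts_equiv}.
HB.instance Definition _ := Choice.on tsquot.
HB.instance Definition _ := EqQuotient.on tsquot.

Definition tspi (x : B) : tsquot := \pi_tsquot x.

Lemma tspiP x y : tspi x = tspi y <-> tsideal (x - y).
Proof. by split=> [/eqP|H]; [|apply/eqP]; rewrite eqmodE => *; exact/asboolP. Qed.

Lemma tspi_repr u : tspi (repr u) = u.
Proof. exact: reprK. Qed.

Let add (u v : tsquot) : tsquot := tspi (repr u + repr v).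
Let opp (u : tsquot) : tsquot := tspi (- repr u).
Let mul (u v : tsquot) : tsquot := tspi (repr u * repr v).

Let piD x y : add (tspi x) (tspi y) = tspi (x + y).
Proof.
apply/tspiP; rewrite opprD addrACA.
by apply: tsideal_add; apply/tspiP; rewrite tspi_repr.
Qed.

Let piN x : opp (tspi x) = tspi (- x).
Proof.
by apply/tspiP; rewrite -opprD; apply: tsideal_opp; apply/tspiP; rewrite tspi_repr.
Qed.

Let piM x y : mul (tspi x) (tspi y) = tspi (x * y).
Proof.
have Hx : tsideal (repr (tspi x) - x) by apply/tspiP; rewrite tspi_repr.
have Hy : tsideal (repr (tspi y) - y) by apply/tspiP; rewrite tspi_repr.
apply/tspiP; set x' := repr _ in Hx *; set y' := repr _ in Hy *.
have -> : x' * y' - x * y = 1 * (x' - x) * y' + x * (y' - y) * 1.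
  by rewrite mul1r mulr1 mulrBl mulrBr addrA subrK.
by apply: tsideal_add; apply: tsideal_mul.
Qed.

Let addA : associative add.
Proof.
by move=> u v w; rewrite -[u]tspi_repr -[v]tspi_repr -[w]tspi_repr !piD addrA.
Qed.
Let addC : commutative add.
Proof. by move=> u v; rewrite -[u]tspi_repr -[v]tspi_repr !piD addrC. Qed.
Let add0 : left_id (tspi 0) add.
Proof. by move=> u; rewrite -[u]tspi_repr piD add0r. Qed.
Let addN : left_inverse (tspi 0) opp add.
Proof. by move=> u; rewrite -[u]tspi_repr piN piD addNr. Qed.
Let mulA : associative mul.
Proof.
by move=> u v w; rewrite -[u]tspi_repr -[v]tspi_repr -[w]tspi_repr !piM mulrA.
Qed.
Let mul1 : left_id (tspi 1) mul.
Proof. by move=> u; rewrite -[u]tspi_repr piM mul1r. Qed.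
Let mulx1 : right_id (tspi 1) mul.
Proof. by move=> u; rewrite -[u]tspi_repr piM mulr1. Qed.
Let mulDl : left_distributive mul add.
Proof.
by move=> u v w; rewrite -[u]tspi_repr -[v]tspi_repr -[w]tspi_repr !(piM, piD) mulrDl.
Qed.
Let mulDr : right_distributive mul add.
Proof.
by move=> u v w; rewrite -[u]tspi_repr -[v]tspi_repr -[w]tspi_repr !(piM, piD) mulrDr.
Qed.

HB.instance Definition _ :=
  GRing.isPzRing.Build tsquot addA addC add0 addN mulA mul1 mulx1 mulDl mulDr.

Lemma tspi_additive : zmod_morphism tspi.
Proof. by move=> x y; rewrite -piD -piN. Qed.
Lemma tspi_multiplicative : monoid_morphism tspi.
Proof. by split=> // x y; rewrite -piM. Qed.

HB.instance Definition _ := GRing.isZmodMorphism.Build B tsquot tspi tspi_additive.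
HB.instance Definition _ :=
  GRing.isMonoidMorphism.Build B tsquot tspi tspi_multiplicative.

End TwoSidedQuotient.

(* V^{(x) k} has the basis indexed by words of length k; operators on it are
   the matrices whose rows and columns are indexed by the enumeration of words. *)
Definition word (N k : nat) := {ffun 'I_k -> 'I_N}.
Notation "''Op[' A ]_( N , k )" := 'M[A]_(#|{: word N k}|)
  (at level 8, A at level 2, format "''Op[' A ]_( N ,  k )") : type_scope.

Section Tensor.
Variables (A : pzRingType) (N : nat).

Definition op_of k (E : word N k -> word N k -> A) : 'Op[A]_(N, k) :=
  \matrix_(a, b) E (enum_val a) (enum_val b).

Definition entry k (X : 'Op[A]_(N, k)) (a b : word N k) : A :=
  X (enum_rank a) (enum_rank b).

Definition op1 (X : 'M[A]_N) : 'Op[A]_(N, 1) :=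
  op_of (fun a b => X (a ord0) (b ord0)).

(* X acting in the tensor factors f 0, ..., f (m - 1), for f injective. *)
Definition legs m k (f : 'I_m -> 'I_k) (X : 'Op[A]_(N, m)) : 'Op[A]_(N, k) :=
  op_of (fun a b => entry X [ffun t => a (f t)] [ffun t => b (f t)]
                    *+ [forall j, (j \notin codom f) ==> (a j == b j)]).

(* I^{(x) i} (x) X (x) I^{(x) (k - i - m)}, meaningful for i + m <= k;
   the value at k = 0 is junk. *)
Definition act m k (i : nat) (X : 'Op[A]_(N, m)) : 'Op[A]_(N, k) :=
  match k return 'Op[A]_(N, k) with
  | 0 => 1%:M
  | k'.+1 => legs (fun t : 'I_m => inord (i + t) : 'I_k'.+1) X
  end.

Definition insert k (i : 'I_k.+1) (x : 'I_N) (a : word N k) : word N k.+1 :=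
  [ffun j => if unlift i j is Some j' then a j' else x].

(* The trace over factor i; the remaining k factors keep their order. *)
Definition ptrace k (i : 'I_k.+1) (X : 'Op[A]_(N, k.+1)) : 'Op[A]_(N, k) :=
  op_of (fun a b => \sum_x entry X (insert i x a) (insert i x b)).

Definition flip : 'Op[A]_(N, 2) :=
  op_of (fun a b => ((a ord0 == b ord_max) && (a ord_max == b ord0))%:R).

End Tensor.

Arguments flip : clear implicits.

Section HeckeSymmetry.
Variables (F : fieldType) (N : nat) (q : F).
Implicit Types R Psi : 'Op[F]_(N, 2).

Definition qint (k : nat) : F := (q ^+ k - q ^- k) / (q - q^-1).

Definition braiding R :=
  act 3 0 R *m act 3 1 R *m act 3 0 R = act 3 1 R *m act 3 0 R *m act 3 1 R.

Definition hecke_symmetry R :=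
  [/\ q \notin [:: 0; 1; -1], braiding R
    & (q%:M - R) *m (q^-1%:M + R) = 0].

Definition skew_inverse R Psi :=
  ptrace (inord 1) (act 3 0 R *m act 3 1 Psi) = flip F N /\
  ptrace (inord 1) (act 3 0 Psi *m act 3 1 R) = flip F N.

Definition skew_invertible R := exists Psi, skew_inverse R Psi.

(* The value at k = 0 is a convention; A^{(k)} (x) I is [act _ 0]. *)
Fixpoint skew_symmetrizer R (k : nat) : 'Op[F]_(N, k) :=
  match k return 'Op[F]_(N, k) with
  | 0 => 1%:M
  | k'.+1 =>
    if k' == 0 then 1%:M else
    let B := act k'.+1 0 (skew_symmetrizer R k') in
    (qint k'.+1)^-1 *:
      (B *m ((q ^+ k')%:M - qint k' *: act k'.+1 k'.-1 R) *m B)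
  end.

(* \rank is the dimension of the image of the operator. *)
Definition GL_type R :=
  [/\ hecke_symmetry R, skew_invertible R,
      \rank (skew_symmetrizer R N) = 1%N & skew_symmetrizer R N.+1 = 0].

Definition qtrace_mx Psi : 'Op[F]_(N, 1) := ptrace (inord 1) Psi.

End HeckeSymmetry.

(* Matrices over a ring A; sc : F -> A embeds the scalars. *)
Section OverAlgebra.
Variables (F : fieldType) (A : pzRingType) (sc : F -> A) (N : nat).
Variables (R Psi : 'Op[F]_(N, 2)).

(* Tr_(1..k) (C_1 ... C_k X), where C = Tr_(2) Psi. *)
Definition qtrace k (X : 'Op[A]_(N, k)) : A :=
  \tr (map_mx sc (\prod_(i < k) act k i (qtrace_mx Psi)) *m X).

(* [copy k X i] is X with overlined index i + 1, acting on V^{(x) k}. *)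
Fixpoint copy k (X : 'M[A]_N) (i : nat) : 'Op[A]_(N, k) :=
  if i is j.+1 then
    map_mx sc (act k j R) *m copy k X j *m map_mx sc (invmx (act k j R))
  else act k 0 (op1 X).

Variables (M D : 'M[A]_N).
Let Rh : 'Op[A]_(N, 2) := map_mx sc R.
Let Ri : 'Op[A]_(N, 2) := map_mx sc (invmx R).
Let M1 : 'Op[A]_(N, 2) := act 2 0 (op1 M).
Let D1 : 'Op[A]_(N, 2) := act 2 0 (op1 D).

(* Left-hand side minus right-hand side of the three matrix relations. *)
Definition rel_MM : 'Op[A]_(N, 2) :=
  Rh *m M1 *m Rh *m M1 - M1 *m Rh *m M1 *m Rh.
Definition rel_DD : 'Op[A]_(N, 2) :=
  Ri *m D1 *m Ri *m D1 - D1 *m Ri *m D1 *m Ri.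
Definition rel_DM : 'Op[A]_(N, 2) :=
  D1 *m Rh *m M1 - (Rh *m M1 *m Ri *m D1 *m Ri + 1%:M).

Variable q : F.
Let AN : 'Op[A]_(N, N) := map_mx sc (skew_symmetrizer q R N).

Definition qdet_M : A :=
  sc (q ^+ (N ^ 2)) * qtrace (AN *m \prod_(j < N) copy N M j).

Definition qdet_D : A :=
  sc (q ^+ (N ^ 2)) * qtrace (AN *m \prod_(j < N) copy N D (rev_ord j)).

End OverAlgebra.

Section QuantumDouble.
Variables (F : fieldType) (N : nat) (R : 'Op[F]_(N, 2)).

(* inl (i, j) stands for m_i^j and inr (i, j) for \partial_i^j. *)
Definition qd_gen : choiceType := (('I_N * 'I_N) + ('I_N * 'I_N))%type.
Definition qd_free : nzRingType := {malg F[{fmonom qd_gen}]}.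
Definition qd_scal0 (c : F) : qd_free := c%:MP.
Definition qd_gen0 (g : qd_gen) : qd_free := << fmu g >>.

Definition qd_M0 : 'M[qd_free]_N := \matrix_(i, j) qd_gen0 (inl (i, j)).
Definition qd_D0 : 'M[qd_free]_N := \matrix_(i, j) qd_gen0 (inr (i, j)).

Definition qd_relator (x : qd_free) : Prop :=
  exists i j, [\/ x = rel_MM qd_scal0 R qd_M0 i j,
                  x = rel_DD qd_scal0 R qd_D0 i j
                | x = rel_DM qd_scal0 R qd_M0 qd_D0 i j].

(* A pzRingType, so that no nontriviality has to be proved; its F-algebra
   structure is the map qd_scal. *)
Definition qdouble : pzRingType := tsquot qd_relator.
Definition qd_scal (c : F) : qdouble := tspi qd_relator (qd_scal0 c).
Definition qd_M : 'M[qdouble]_N := map_mx (tspi qd_relator) qd_M0.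
Definition qd_D : 'M[qdouble]_N := map_mx (tspi qd_relator) qd_D0.

End QuantumDouble.

(* Main.v *)
Require Import Defs.
From HB Require Import structures.
From mathcomp Require Import all_boot all_order all_algebra.
From mathcomp Require Import ring.
From mathcomp Require Import reals.
From mathcomp.real_closed Require Import complex.
From mathcomp.multinomials Require Import monalg.

(** The indices of braidings and copies start at 0: [r_i] is [R] acting in the two
    consecutive tensor factors [i+1] and [i+2], and the copies of [X] are [X_0], [X_1],
    and so on. Subscripts that name tensor factors, as in [R_12] and [C_1 C_2], start
    at 1.

    The heart of the matter is a factorization without any projector or trace. Let
    [x] be an element with [r_i x = - q^(-1) x] for all [i < k-1]. Then
      [(L_0 + c_0) ... (L_(k-1) + c_(k-1)) x
         = q^(k(k-1)) M_0 ... M_(k-1) D_(k-1) ... D_0 x],   [c_j = q^j j_q]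
    (lemma [capelli]). The induction is on [k]: the last factor commutes with [r_i]
    for [i < k-2], so [(L_(k-1) + c_(k-1)) x] can play the role of [x] for the first
    [k-1] factors; it remains to move [M_(k-1)] to the left through
    [D_(k-2) ... D_0] (lemma [Dprod_copy]), and the terms that the inhomogeneous
    permutation relation produces on the way add up to [- c_(k-1) D_(k-2) ... D_0 x],
    which the shift cancels.

    The element [x] is the skew-symmetrizer [A = A^(N)]. That [A] absorbs every [r_i]
    from both sides, up to the factor [- q^(-1)], is proved by comparing its recursion
    with the alternating sums of products of consecutive [r_i] ([asym_absorbs]).
    The right-hand factor [A] is available because the quantum trace is cyclic with
    respect to [A]: the matrix [C_1 C_2] commutes with [R] ([qtrace_mx_comm]), which
    follows from the braid relation and skew-invertibility through the identities
    [R^(-1) C_2 = C_1 Psi_21] and [C_2 R^(-1) = Psi_21 C_1] ([RI_C], [C_RI]).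

    Finally [A] has rank one and commutes with [M_0 ... M_(N-1)] and with
    [D_(N-1) ... D_0], so that [A X A = Tr (A X) A] ([rank1_sandwich]) splits the trace
    into the product of the two determinants. The constant comes from
    [Tr_R A = q^(-N^2)] ([qtrace_skewN]): tracing out one factor of [A^(k+1)] gives a
    multiple of [A^(k)] ([trace_skewS]), and the multiple is known because
    [A^(N+1) = 0] forces [Tr C = q^(-N) N_q] ([trace_C]). *)

Set Implicit Arguments.
Unset Strict Implicit.
Unset Printing Implicit Defensive.
Import GRing.Theory.
Local Open Scope ring_scope.

(** * Antisymmetrizers of the Hecke relations *)

Section QInt.
Variables (F : fieldType) (q : F).
Hypotheses (q0 : q != 0) (qq : q - q^-1 != 0).

Lemma qint0 : qint q 0 = 0.
Proof. by rewrite /qint expr0 invr1 subrr mul0r. Qed.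

Lemma qint1 : qint q 1 = 1.
Proof. by rewrite /qint expr1 divff. Qed.

Lemma qintS k : qint q k.+1 = q ^+ k + q^-1 * qint q k.
Proof.
apply: (mulIf qq); rewrite /qint divfK // [in RHS]mulrDl -mulrA divfK // !mulrBr -!exprVn.
by rewrite -exprS -[q ^+ k * q]exprSr [q ^+ k * _]mulrC addrA subrK.
Qed.

Lemma qint_shift k : q ^+ k.+1 * qint q k.+1 = q ^+ k * qint q k + q ^+ k.*2.+1.
Proof.
rewrite qintS mulrDr addrC exprS; congr (_ + _).
  by rewrite [q * _]mulrC -mulrA mulVKf.
by rewrite -mulrA -exprD addnn -exprS.
Qed.

End QInt.

Section HeckeRelations.
Variables (F : fieldType) (q : F) (Q : pzRingType) (s : F -> Q).

(** [s] maps the scalars into the centre of [Q]. *)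
Definition central_scalars := forall c x, s c * x = x * s c.

(** The relations of the Hecke algebra on [n] strands for [r 0], ..., [r (n - 2)];
    nothing is asked of the other elements of the sequence. *)
Definition hecke_relations (n : nat) (r : nat -> Q) :=
  [/\ forall i, (i.+1 < n)%N -> (s q - r i) * (s q^-1 + r i) = 0,
      forall i, (i.+2 < n)%N -> r i * r i.+1 * r i = r i.+1 * r i * r i.+1
    & forall i j, (i.+1 < j)%N -> (j.+1 < n)%N -> r i * r j = r j * r i].

(** The recursion of the skew-symmetrizers, in an arbitrary ring; the values at 0
    and 1 are 1. *)
Fixpoint asym (r : nat -> Q) (k : nat) : Q :=
  if k is k'.+1 then
    if k' == 0 then 1 else
    s (qint q k'.+1)^-1 *
      (asym r k' * (s (q ^+ k') - s (qint q k') * r k'.-1) * asym r k')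
  else 1.

(** The alternating sum over the coset representatives of the Hecke algebra on [k]
    strands in the one on [k + 1] strands:
    [alt r k.+1 = q^k - q^(k-1) r_(k-1) + q^(k-2) r_(k-1) r_(k-2) - ...]. *)
Fixpoint alt (r : nat -> Q) (k : nat) : Q :=
  if k is k'.+1 then s (q ^+ k') - r k'.-1 * alt r k' else 0.

(** [r_i x = - q^(-1) x] for all [i < n - 1], and its mirror image. *)
Definition absorbs_left n (r : nat -> Q) x :=
  forall i, (i.+1 < n)%N -> r i * x = - (s q^-1 * x).
Definition absorbs_right n (r : nat -> Q) x :=
  forall i, (i.+1 < n)%N -> x * r i = - (s q^-1 * x).

End HeckeRelations.

Lemma asym_morph (F : fieldType) (q : F) (Q1 Q2 : pzRingType)
    (s1 : F -> Q1) (s2 : F -> Q2) (f : {rmorphism Q1 -> Q2}) r1 r2 k :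
  (forall c, f (s1 c) = s2 c) ->
  (forall i, (i.+1 < k)%N -> f (r1 i) = r2 i) ->
  f (asym q s1 r1 k) = asym q s2 r2 k.
Proof.
move=> fs; elim: k => [|[|k] IH] fr; rewrite ?rmorph1 //=.
rewrite !rmorphM rmorphB rmorphM /= !fs fr // -[X in f X]/(asym q s1 r1 k.+1).
by rewrite IH // => i lik; apply: fr; apply: ltnW.
Qed.

Section Antisymmetrizer.
Variables (F : fieldType) (q : F).
Hypothesis qq : q - q^-1 != 0.
Hypothesis qn : forall k, (0 < k)%N -> qint q k != 0.

Section OneSided.
Variables (Q : pzRingType) (s : {rmorphism F -> Q}).
Hypothesis sC : central_scalars s.
Variables (n : nat) (r : nat -> Q).
Hypothesis Hr : hecke_relations q s n r.

Local Notation A := (asym q s r).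
Local Notation a := (alt q s r).

Lemma asymE k : A k.+2 = s (qint q k.+2)^-1 *
  (A k.+1 * (s (q ^+ k.+1) - s (qint q k.+1) * r k) * A k.+1).
Proof. by []. Qed.

Lemma asym1 : A 1 = 1. Proof. by []. Qed.

Lemma altS k : a k.+1 = s (q ^+ k) - r k.-1 * a k. Proof. by []. Qed.

Lemma alt0 : a 0 = 0. Proof. by []. Qed.

#[local] Opaque asym alt.

Lemma asym_comm k x : (forall i, (i.+1 < k)%N -> r i * x = x * r i) ->
  A k * x = x * A k.
Proof.
elim: k => [|[|k] IH] H; [by rewrite mul1r mulr1..|rewrite asymE].
have Ax : A k.+1 * x = x * A k.+1 by apply: IH => i lik; apply/H/ltnW.
have bx : (s (q ^+ k.+1) - s (qint q k.+1) * r k) * x =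
          x * (s (q ^+ k.+1) - s (qint q k.+1) * r k).
  rewrite mulrBl mulrBr sC; congr (_ - _).
  by rewrite -mulrA H // !mulrA sC.
set u := asym _ _ _ _ in Ax *; set b := (_ - _) in bx *.
rewrite -!mulrA Ax (mulrA b x) bx -mulrA (mulrA u x) Ax -mulrA.
by rewrite (mulrA (s _) x) sC -mulrA.
Qed.

Lemma asym_absorb_r k x : absorbs_right q s k r x -> x * A k = x.
Proof.
elim: k => [|[|k] IH] Hx; [exact: mulr1..|].
have xA : x * A k.+1 = x by apply: IH => i lik; apply/Hx/ltnW.
set b := s (q ^+ k.+1) - s (qint q k.+1) * r k.
have xb : x * b = s (qint q k.+2) * x.
  rewrite mulrBr -sC mulrA -sC -mulrA Hx // mulrN opprK mulrA -(rmorphM s).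
  by rewrite -mulrDl -(rmorphD s) [in RHS]qintS // [q^-1 * _]mulrC.
rewrite asymE -/b mulrA -sC -!mulrA (mulrA x) xA (mulrA x) xb -mulrA xA mulrA.
by rewrite -(rmorphM s) mulVf ?rmorph1 ?mul1r // qn.
Qed.

Lemma alt_comm k j : (k <= j)%N -> (j.+1 < n)%N -> r j * a k = a k * r j.
Proof.
case: Hr => _ _ far; elim: k => [|k IH] lkj ljn; first by rewrite mulr0 mul0r.
rewrite altS mulrBr mulrBl sC mulrA; congr (_ - _).
case: k IH lkj => [|k] IH lkj; first by rewrite !mulr0 mul0r.
by rewrite -(far k j) // -!mulrA IH // ltnW.
Qed.

Lemma alt_absorb k x : absorbs_left q s k r x -> a k * x = s (qint q k) * x.
Proof.
elim: k => [|k IH] Hx; first by rewrite qint0 rmorph0 !mul0r.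
have Hk : a k * x = s (qint q k) * x by apply: IH => i lik; apply/Hx/ltnW.
rewrite altS mulrBl -mulrA Hk mulrA -sC -mulrA.
case: k {IH Hk} Hx => [|k] Hx.
  by rewrite qint0 rmorph0 mul0r subr0 qint1 // expr0.
rewrite Hx // mulrN opprK mulrA -(rmorphM s) -mulrDl -(rmorphD s).
by rewrite [in RHS]qintS // [q^-1 * _]mulrC.
Qed.

Lemma absorbs_rightP x z :
  x * (s q^-1 + z) = 0 <-> x * z = - (s q^-1 * x).
Proof.
rewrite mulrDr -sC addrC; split=> [/eqP|->]; last by rewrite addNr.
by rewrite addr_eq0 => /eqP.
Qed.

(** For the last generator this is the Hecke relation and the braid relation; for the
    others it is the induction hypothesis, as [A^(k) = A^(k) A^(k-1)]. *)
Lemma asym_alt_absorb k : (k.+1 < n)%N ->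
  (forall j, (j <= k.+1)%N -> absorbs_right q s j r (A j)) ->
  absorbs_right q s k.+2 r (A k.+1 * a k.+2).
Proof.
case: Hr => Hh Hb Hf; elim: k => [|k IH] lkn HA i lik.
  case: i lik => // _; apply/absorbs_rightP.
  by rewrite asym1 mul1r !altS alt0 mulr0 subr0 /= expr0 rmorph1 mulr1 expr1 Hh.
apply/absorbs_rightP; rewrite ltnS leq_eqVlt in lik.
case/orP: lik => [/eqP[->]|lik].
  rewrite (altS k.+2) (altS k.+1) /=.
  set u := A k.+2; set b := a k.+1; set x := r k; set y := r k.+1.
  have byC : b * y = y * b by rewrite -alt_comm.
  have xyx : x * y * x = y * x * y by exact: Hb.
  have ux : u * x = - (s q^-1 * u) by exact: HA.
  have Hy : (s q - y) * (s q^-1 + y) = 0 by exact: Hh.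
  clearbody u b x y.
  have uyx : u * y * x * y = - (s q^-1 * (u * y * x)).
    by rewrite -2!(mulrA u) -xyx !mulrA ux !mulNr.
  have uy : u * (s (q ^+ k.+2) - y * s (q ^+ k.+1)) * (s q^-1 + y) = 0.
    by rewrite -sC exprS mulrC (rmorphM s) -mulrBr -!mulrA Hy !mulr0.
  rewrite (mulrBr y) opprB addrA addrAC (mulrDr u) mulrDl uy add0r !mulrA.
  apply/absorbs_rightP.
  by rewrite -(mulrA _ b y) byC mulrA uyx mulNr !mulrA.
have lin : (i.+1 < n)%N by apply: leq_trans lkn; apply: ltnW.
have HAk : A k.+2 = A k.+2 * A k.+1.
  by rewrite asym_absorb_r // => j ljk; apply: HA => //; apply: ltnW.
rewrite altS mulrBr mulrBl.
have -> : A k.+2 * s (q ^+ k.+2) * (s q^-1 + r i) = 0.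
  rewrite -sC -mulrA; suff -> : A k.+2 * (s q^-1 + r i) = 0 by rewrite mulr0.
  exact/absorbs_rightP/HA.
have rA : A k.+1 * r k.+1 = r k.+1 * A k.+1.
  by apply: asym_comm => j ljk; apply: Hf.
have /absorbs_rightP IHi := IH (ltnW lkn) (fun j lj => HA j (leqW lj)) i lik.
rewrite HAk /= mulrA -[A k.+2 * A k.+1 * r k.+1]mulrA rA -!mulrA.
by rewrite (mulrA (A k.+1)) IHi !mulr0 subr0.
Qed.

(** [(k+1)_q A^(k+1) = A^(k) alt_(k+1)]: both the left and the right absorption by
    [A^(k)] enter, but only the right absorption by [A^(k+1)] comes out. *)
Lemma asym_step k : (k.+1 < n)%N -> absorbs_left q s k.+1 r (A k.+1) ->
  (forall j, (j <= k.+1)%N -> absorbs_right q s j r (A j)) ->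
  absorbs_right q s k.+2 r (A k.+2).
Proof.
move=> lkn lA rA; have rAa := asym_alt_absorb lkn rA.
suff -> : A k.+2 = s (qint q k.+2)^-1 * (A k.+1 * a k.+2).
  by move=> i lik; rewrite -mulrA rAa // mulrN !mulrA -!(rmorphM s) [_ / q]mulrC.
rewrite asymE altS /=; congr (_ * _).
rewrite -[RHS](@asym_absorb_r k.+1) => [|i lik]; last first.
  by have := rAa i (ltnW lik); rewrite altS.
rewrite -!mulrA; congr (_ * _).
by rewrite !mulrBl -!mulrA alt_absorb // (mulrA (r k)) -sC -mulrA.
Qed.

End OneSided.

Section Converse.
Variables (Q : pzRingType) (s : {rmorphism F -> Q}).
Hypothesis sC : central_scalars s.
Variables (n : nat) (r : nat -> Q).
Hypothesis Hr : hecke_relations q s n r.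

(** The scalars of the converse ring. The recursion of the skew-symmetrizers reads the
    same there, while left and right absorption are exchanged. *)
Definition conv_scal (c : F) : Q^c := s c.

Fact conv_scal_zmod : zmod_morphism conv_scal.
Proof. exact: (rmorphB s). Qed.
Fact conv_scal_monoid : monoid_morphism conv_scal.
Proof.
by split=> [|x y]; [exact: (rmorph1 s)|rewrite mulrC; exact: (rmorphM s)].
Qed.
HB.instance Definition _ := GRing.isZmodMorphism.Build F Q^c conv_scal conv_scal_zmod.
HB.instance Definition _ := GRing.isMonoidMorphism.Build F Q^c conv_scal conv_scal_monoid.

Lemma asym_conv k : asym q conv_scal (r : nat -> Q^c) k = asym q s r k.
Proof.
elim: k => [|[|k] IH] //; rewrite !asymE IH; set u := asym q s r k.+1.
transitivity (s (qint q k.+2)^-1 *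
    (u * ((s (q ^+ k.+1) - r k * s (qint q k.+1)) * u)) : Q).
  have := sC (qint q k.+2)^-1 (u * ((s (q ^+ k.+1) - r k * s (qint q k.+1)) * u)).
  by move/esym.
by rewrite (mulrA u) -(sC _ (r k)).
Qed.

Lemma conv_hecke : hecke_relations q conv_scal n (r : nat -> Q^c).
Proof.
case: Hr => Hh Hb Hf; split=> [i lin|i lin|i j lij ljn].
- have c1 : GRing.comm (s q - r i) (s q^-1 + r i).
    apply: commrD; apply/commr_sym/commrB; [exact: sC|exact: sC| |by []].
    exact/commr_sym/sC.
  have H := Hh i lin; rewrite c1 in H; exact: H.
- have H := Hb i lin; rewrite -!mulrA in H; exact: H.
- exact/esym/Hf.
Qed.

Lemma conv_central : central_scalars conv_scal.
Proof. by move=> c x; exact: (esym (sC c x)). Qed.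

End Converse.

Section TwoSided.
Variables (Q : pzRingType) (s : {rmorphism F -> Q}).
Hypothesis sC : central_scalars s.
Variables (n : nat) (r : nat -> Q).
Hypothesis Hr : hecke_relations q s n r.
Local Notation A := (asym q s r).

Lemma asym_absorbs k : (k <= n)%N ->
  absorbs_left q s k r (A k) /\ absorbs_right q s k r (A k).
Proof.
have [m] := ubnP k; elim: m k => // m IH [|[|k]] // lkm lkn.
have IHj j : (j <= k.+1)%N ->
    absorbs_left q s j r (A j) /\ absorbs_right q s j r (A j).
  move=> ljk; apply: IH; first exact: leq_ltn_trans ljk lkm.
  exact: leq_trans ljk (ltnW lkn).
split; last by apply: (asym_step sC Hr) => // [|j /IHj[]//]; case: (IHj k.+1).
have convl j : absorbs_right q (conv_scal s) j (r : nat -> Q^c) (A j) <->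
    absorbs_left q s j r (A j).
  by split=> H i lij; have := H i lij; rewrite [s _ * _]sC.
apply/convl; rewrite -(asym_conv sC).
apply: (asym_step (conv_central sC) (conv_hecke sC Hr)) => // [|j /IHj[lA _]].
  case: (IHj k.+1) => // _ rA i lij; rewrite (asym_conv sC).
  by have H := rA i lij; rewrite sC in H; exact: H.
by rewrite (asym_conv sC); apply/convl.
Qed.

Lemma asym_idem k : (k <= n)%N -> A k * A k = A k.
Proof. by move=> lkn; apply: (asym_absorb_r sC); case: (asym_absorbs lkn). Qed.

End TwoSided.
End Antisymmetrizer.

(** * Factorization of the shifted product *)

(** [y] commutes with an ordered product as soon as it commutes with the product of
    two consecutive factors and with each of the other factors. *)
Lemma commr_prod_pair (Q : pzRingType) (x : nat -> Q) y j k :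
  (forall i, (i < k)%N -> i != j -> i != j.+1 -> y * x i = x i * y) ->
  y * (x j * x j.+1) = x j * x j.+1 * y -> (j.+1 < k)%N ->
  y * \prod_(i < k) x i = (\prod_(i < k) x i) * y.
Proof.
elim: k => // k IH xy yj jk; rewrite ltnS leq_eqVlt in jk.
case/orP: jk => [/eqP ek|jk]; last first.
  rewrite big_ord_recr /= mulrA IH // => [|i ik]; last exact/xy/ltnW.
  by rewrite -!mulrA xy // neq_ltn ?jk ?orbT // (ltn_trans (ltnSn j)) ?orbT.
rewrite -{k IH}ek in xy *; rewrite !big_ord_recr /= -mulrA mulrA.
have -> : y * \prod_(i < j) x i = (\prod_(i < j) x i) * y.
  apply: commr_prod => i _; apply: xy.
  - by apply: ltn_trans (ltn_ord i) _; rewrite ltnS leqnSn.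
  - by rewrite neq_ltn ltn_ord.
  - by rewrite neq_ltn ltnS (ltnW (ltn_ord i)).
by rewrite -mulrA yj !mulrA.
Qed.

Section Capelli.
Variables (F : fieldType) (q : F).
Hypotheses (q0 : q != 0) (qq : q - q^-1 != 0).
Variables (Q : pzRingType) (s : {rmorphism F -> Q}).
Hypothesis sC : central_scalars s.
Variables (n : nat) (r ri : nat -> Q).
Hypothesis Hr : hecke_relations q s n r.
Hypothesis rK : forall i, (i.+1 < n)%N -> r i * ri i = 1.
Hypothesis riK : forall i, (i.+1 < n)%N -> ri i * r i = 1.

(** The copies [x_(i+1) = r_i x_i r_i^(-1)] of an element [x]. *)
Fixpoint cp (x : Q) (i : nat) : Q :=
  if i is j.+1 then r j * cp x j * ri j else x.

(** An element that acts in the first tensor factor only. *)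
Definition first_leg (x : Q) :=
  forall i, (0 < i)%N -> (i.+1 < n)%N -> r i * x = x * r i.

Lemma scalAC c x y : x * (s c * y) = s c * (x * y).
Proof. by rewrite mulrA -sC mulrA. Qed.

Lemma intertwine_inv (a a' b b' x y : Q) :
  a' * a = 1 -> b * b' = 1 -> a * x = y * b -> a' * y = x * b'.
Proof.
move=> aa bb H; rewrite -[LHS]mulr1 -bb mulrA -(mulrA a' y) -H.
by rewrite (mulrA a' a) aa mul1r.
Qed.

Lemma ri_comm i x : (i.+1 < n)%N -> r i * x = x * r i -> ri i * x = x * ri i.
Proof. by move=> lin; apply: intertwine_inv; [exact: riK|exact: rK]. Qed.

Lemma invM a a' b b' : a * a' = 1 -> b * b' = 1 -> a * b * (b' * a') = 1 :> Q.
Proof. by move=> aa bb; rewrite mulrA -(mulrA a b) bb mulr1. Qed.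

Lemma cpM x y j : (j < n)%N -> cp (x * y) j = cp x j * cp y j.
Proof.
elim: j => //= j IH ljn; rewrite IH 1?ltnW // -!mulrA.
by rewrite (mulrA (ri j) (r j)) riK // mul1r.
Qed.

Lemma cp_comm_gt x i j : first_leg x -> (j < i)%N -> (i.+1 < n)%N ->
  r i * cp x j = cp x j * r i.
Proof.
case: Hr => _ _ Hf Hx; elim: j => [|j IH] lji lin /=; first exact: Hx.
have Hji : r j * r i = r i * r j by apply: Hf.
have ljn : (j.+1 < n)%N by apply: ltn_trans lin; apply: leqW.
rewrite !mulrA -Hji -(mulrA (r j)) IH // 1?ltnW // -!mulrA.
by rewrite (ri_comm ljn Hji).
Qed.

Lemma cp_comm_lt x i j : first_leg x -> (i.+1 < j)%N -> (j < n)%N ->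
  r i * cp x j = cp x j * r i.
Proof.
case: Hr => _ Hb Hf Hx; elim: j => // j IH lij ljn.
rewrite ltnS leq_eqVlt in lij; case/orP: lij => [/eqP ej|lij] /=.
- rewrite -{j IH}ej in ljn *; have lin := ltnW ljn; rewrite /=.
  have c1 := cp_comm_gt Hx (ltnSn i) ljn.
  have c2 : r i.+1 * r i * r i.+1 = r i * (r i.+1 * r i).
    by rewrite mulrA; apply/esym/Hb.
  have := intertwine_inv (invM (riK lin) (riK ljn)) (invM (rK ljn) (rK lin)) c2.
  move: c1 c2; set h := r i.+1 * r i; set h' := ri i * ri i.+1 => c1 c2 c3.
  have -> : r i.+1 * (r i * cp x i * ri i) * ri i.+1 = h * cp x i * h'.
    by rewrite !mulrA.
  clearbody h h'; by rewrite !mulrA -c2 -(mulrA h) c1 -[RHS]mulrA c3 !mulrA.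
- have Hij : r i * r j = r j * r i by apply: Hf.
  rewrite !mulrA Hij -(mulrA (r j)) IH // 1?ltnW // -!mulrA.
  by rewrite (ri_comm ljn (esym Hij)).
Qed.

(** All the triples [(r_j, x_j, y_j)] are conjugate to [(r_0, x, y)], by an element
    that does not depend on [x] and [y]; so a relation between [r_0], [x], [y]
    holds between their copies. *)
Lemma cp_conj j : (j.+1 < n)%N ->
  exists T T', [/\ T' * T = 1, r j = T * r 0 * T', ri j = T * ri 0 * T' &
    forall x, first_leg x -> cp x j = T * x * T'].
Proof.
elim: j => [|j IH] ljn.
  by exists 1, 1; rewrite !mul1r !mulr1; split=> // x _; rewrite mul1r mulr1.
have lin := ltnW ljn; have [T [T' [TT Hrj Hrij Hx]]] := IH lin.
case: Hr => _ Hb _.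
have gg := invM (rK lin) (rK ljn); have g'g := invM (riK ljn) (riK lin).
have gr : r j * r j.+1 * r j = r j.+1 * (r j * r j.+1) by rewrite mulrA Hb.
exists (r j * r j.+1 * T), (T' * (ri j.+1 * ri j)); split.
- by rewrite -!mulrA (mulrA (ri j)) riK // mul1r (mulrA (ri j.+1)) riK // mul1r.
- rewrite -[LHS]mulr1 -gg !mulrA; congr (_ * _ * _).
  by rewrite -2!(mulrA (r j * r j.+1)) -Hrj gr !mulrA.
- have gri' : r j * r j.+1 * ri j = ri j.+1 * (r j * r j.+1).
    by apply: esym; apply: (intertwine_inv (riK ljn) (rK lin)).
  rewrite -[LHS]mulr1 -gg !mulrA; congr (_ * _ * _).
  by rewrite -2!(mulrA (r j * r j.+1)) -Hrij gri' !mulrA.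
- move=> x Hx1; rewrite /= !mulrA; congr (_ * _).
  rewrite -2!(mulrA (r j * r j.+1)) -Hx // -(mulrA (r j)) (@cp_comm_gt x j.+1) //.
  by rewrite -!mulrA rK // mulr1.
Qed.

Lemma cpS x j : cp x j.+1 = r j * cp x j * ri j. Proof. by []. Qed.

Variables (m d : Q).
Hypotheses (Hm : first_leg m) (Hd : first_leg d).
Hypothesis RMM : (1 < n)%N -> r 0 * m * r 0 * m = m * r 0 * m * r 0.
Hypothesis RDD : (1 < n)%N -> ri 0 * d * ri 0 * d = d * ri 0 * d * ri 0.
Hypothesis RDM : (1 < n)%N -> d * r 0 * m = r 0 * m * ri 0 * d * ri 0 + 1.

Local Notation M := (cp m).
Local Notation D := (cp d).

Lemma conjM (T T' x y : Q) :
  T' * T = 1 -> T * x * T' * (T * y * T') = T * (x * y) * T'.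
Proof. by move=> TT; rewrite -!mulrA (mulrA T') TT mul1r. Qed.

Lemma copy_MM j : (j.+1 < n)%N -> r j * M j * r j * M j = M j * r j * M j * r j.
Proof.
move=> ljn; have [T [T' [TT -> _ ->]]] := cp_conj ljn; last exact: Hm.
by rewrite !conjM // RMM //; apply: leq_trans ljn.
Qed.

Lemma copy_DD j : (j.+1 < n)%N ->
  ri j * D j * ri j * D j = D j * ri j * D j * ri j.
Proof.
move=> ljn; have [T [T' [TT _ -> ->]]] := cp_conj ljn; last exact: Hd.
by rewrite !conjM // RDD //; apply: leq_trans ljn.
Qed.

Lemma copy_DM j : (j.+1 < n)%N -> D j * r j * M j = M j.+1 * D j * ri j + 1.
Proof.
move=> ljn; have [T [T' [TT rj rij Hx]]] := cp_conj ljn.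
have n1 : (1 < n)%N by apply: leq_trans ljn.
have <- : T * 1 * T' = 1 by rewrite -{1}(rK n1) -conjM // -rj -rij rK.
rewrite cpS (Hx _ Hm) (Hx _ Hd) rj rij !conjM // RDM //.
by rewrite mulrDr mulrDl.
Qed.

(** [M_0 ... M_(k-1)] and [D_(k-1) ... D_0]. *)
Definition Mprod k := \prod_(j < k) M j.
Definition Dprod k := \prod_(j < k) D (rev_ord j).

Lemma MprodS k : Mprod k.+1 = Mprod k * M k.
Proof. by rewrite /Mprod big_ord_recr. Qed.

Lemma DprodS k : Dprod k.+1 = D k * Dprod k.
Proof. by rewrite /Dprod big_ord_recl /= subn1. Qed.

Lemma Mprod0 : Mprod 0 = 1. Proof. exact: big_ord0. Qed.
Lemma Dprod0 : Dprod 0 = 1. Proof. exact: big_ord0. Qed.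

Lemma Dprod_gt i k : (k <= i)%N -> (i.+1 < n)%N -> r i * Dprod k = Dprod k * r i.
Proof.
elim: k => [|k IH] lki lin; first by rewrite Dprod0 mulr1 mul1r.
by rewrite DprodS mulrA (cp_comm_gt Hd) // -!mulrA (IH (ltnW lki) lin).
Qed.

Lemma copy_pair_M i : (i.+1 < n)%N ->
  r i * (M i * M i.+1) = M i * M i.+1 * r i.
Proof.
move=> lin; rewrite cpS !mulrA copy_MM // -(mulrA _ (r i) (ri i)) rK // mulr1.
by rewrite -(mulrA _ (ri i) (r i)) riK // mulr1.
Qed.

Lemma copy_pair_D i : (i.+1 < n)%N ->
  r i * (D i.+1 * D i) = D i.+1 * D i * r i.
Proof.
move=> lin; rewrite cpS -!mulrA; congr (_ * _).
have := copy_DD lin => /(congr1 (fun x => r i * x * r i)).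
by rewrite -!mulrA riK // mulr1 !mulrA rK // mul1r -!mulrA => ->.
Qed.

Lemma Mprod_comm i k : (i.+1 < k)%N -> (k <= n)%N -> r i * Mprod k = Mprod k * r i.
Proof.
move=> ik kn; have lin := leq_trans ik kn.
apply: (@commr_prod_pair _ M _ i k) => // [j jk ji ji1|]; last exact: copy_pair_M.
move: ji; rewrite neq_ltn => /orP[ji|ij]; first exact: cp_comm_gt.
apply: cp_comm_lt => //; last exact: leq_trans jk kn.
by rewrite ltn_neqAle eq_sym ji1.
Qed.

Lemma Dprod_comm i k : (i.+1 < k)%N -> (k <= n)%N -> r i * Dprod k = Dprod k * r i.
Proof.
elim: k => // k IH lik lkn; rewrite ltnS leq_eqVlt in lik.
case/orP: lik => [/eqP ek|lik]; last first.
  by rewrite DprodS mulrA (cp_comm_lt Hd) // -!mulrA (IH lik (ltnW lkn)).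
rewrite -{k IH}ek in lkn *.
by rewrite !DprodS (mulrA (D i.+1)) mulrA copy_pair_D // -mulrA Dprod_gt // !mulrA.
Qed.

Lemma absorbs_left_inv x k : (k <= n)%N -> absorbs_left q s k r x ->
  forall i, (i.+1 < k)%N -> ri i * x = - (s q * x).
Proof.
move=> lkn Hx i lik; have lin := leq_trans lik lkn.
have e : x = - (s q * (r i * x)).
  by rewrite Hx // mulrN opprK mulrA -(rmorphM s) divff // rmorph1 mul1r.
by rewrite {1}e mulrN scalAC (mulrA (ri i)) riK // mul1r.
Qed.

(** Moving [M_k] to the left through [D_(k-1) ... D_0]. In the step, [r_k] commutes
    with [D_(k-1) ... D_0] and [r_k^(-1)] is absorbed by [x], so that
    [M_(k+1) D_(k+1) = r_k M_k D_k r_k^(-1)] reduces it to the previous case; each step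
    adds one term [q^(2k+1)] to [q^k k_q]. *)
Lemma Dprod_copy k x : (k < n)%N -> absorbs_left q s k.+1 r x ->
  Dprod k * (M k * D k) * x =
  s (q ^+ k.*2) * (M k * Dprod k.+1 * x) - s (q ^+ k * qint q k) * (Dprod k * x).
Proof.
elim: k => [|k IH] lkn Hx.
  rewrite !DprodS Dprod0 qint0 mulr0 rmorph0 mul0r subr0 !expr0 rmorph1.
  by rewrite !mul1r mulr1.
have lk2 := absorbs_left_inv lkn Hx (ltnSn k.+1).
have xk : absorbs_left q s k.+1 r x by move=> i lik; apply/Hx/ltnW.
have {}IH := IH (ltnW lkn) xk.
have e1 : Dprod k.+1 * (M k.+1 * D k.+1) * x =
    - (s q * (D k * r k * (Dprod k * (M k * D k) * x))).
  rewrite DprodS !cpS !mulrA -(mulrA _ (ri k) (r k)) riK // mulr1.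
  rewrite -(mulrA _ (ri k) x) lk2 mulrN; congr (- _).
  rewrite scalAC !mulrA; do 3 congr (_ * _).
  by rewrite -(mulrA _ _ (r k)) -Dprod_gt // !mulrA.
have e2 : D k * r k * (M k * Dprod k.+1 * x) =
    Dprod k.+1 * x - s q * (M k.+1 * Dprod k.+2 * x).
  have e3 : D k * ri k = ri k * D k.+1 by rewrite cpS !mulrA riK // mul1r.
  have c : ri k * Dprod k.+2 = Dprod k.+2 * ri k.
    by apply: ri_comm => //; apply: Dprod_comm.
  have DM := copy_DM lkn; have DS := DprodS k.+1.
  move: (M k.+1) (D k.+1) (Dprod k.+2) DM DS e3 c => M' D' Dp' DM DS e3 c.
  rewrite !mulrA DM -(mulrA _ (D k)) e3 !mulrDl mul1r addrC; congr (_ + _).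
  by rewrite -!mulrA (mulrA D') -DS (mulrA (ri k)) c -!mulrA lk2 !mulrN !scalAC.
have e4 : D k * r k * (Dprod k * x) = - (s q^-1 * (Dprod k.+1 * x)).
  by rewrite DprodS -!mulrA (mulrA (r k)) Dprod_gt // -mulrA Hx // !mulrN !scalAC.
rewrite e1 IH mulrBr !scalAC e2 e4 qint_shift // doubleS.
move: (M k.+1 * Dprod k.+2 * x) (Dprod k.+1 * x) => a b.
rewrite !mulrN opprK mulrBr !mulrDr mulrN !mulrA -!(rmorphM s).
rewrite -!exprS -exprSr mulrAC divff // mul1r rmorphD mulrDl.
by rewrite opprD opprB -addrA -opprD; congr (_ - _); exact: addrC.
Qed.

(** The factorization of the shifted product. The product of the last factor and [x]
    still absorbs the generators that concern the remaining factors. *)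
Lemma capelli k x : (k <= n)%N -> absorbs_left q s k r x ->
  \prod_(j < k) (cp (m * d) j + s (q ^+ j * qint q j)) * x =
  s (q ^+ (k * k.-1)) * (Mprod k * Dprod k * x).
Proof.
elim: k x => [|k IH] x lkn Hx.
  by rewrite big_ord0 Mprod0 Dprod0 mul0n expr0 rmorph1 !mul1r.
have Hmd : first_leg (m * d).
  by move=> i i0 lin; rewrite mulrA Hm // -!mulrA Hd.
rewrite big_ord_recr /= -mulrA; set c := s (q ^+ k * qint q k).
have Hy : absorbs_left q s k r ((cp (m * d) k + c) * x).
  move=> i lik; rewrite mulrA mulrDr (cp_comm_lt Hmd) // -(sC _ (r i)) -mulrDl.
  by rewrite -mulrA Hx 1?ltnW // mulrN scalAC.
rewrite (IH _ (ltnW lkn) Hy) cpM // -mulrA mulrDl mulrDr (mulrA (Dprod k)) Dprod_copy //.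
rewrite -/c scalAC subrK scalAC (mulrA (s _)) -(rmorphM s) -exprD MprodS !mulrA.
congr (s (q ^+ _) * _ * _ * _ * _); case: k {IH lkn Hx c Hy} => // k.
by rewrite -muln2 -mulnDr addn2 mulnC.
Qed.

End Capelli.

(** * Operators on words *)

Section Entries.
Variables (A : pzRingType) (N : nat).

Lemma entryE k (E : word N k -> word N k -> A) a b : entry (op_of E) a b = E a b.
Proof. by rewrite /entry mxE !enum_rankK. Qed.

Lemma entryP k (X Y : 'Op[A]_(N, k)) :
  (forall a b, entry X a b = entry Y a b) -> X = Y.
Proof.
move=> H; apply/matrixP=> i j.
by have := H (enum_val i) (enum_val j); rewrite /entry !enum_valK.
Qed.

Lemma sum_word k (f : 'I_(#|{: word N k}|) -> A) :
  \sum_i f i = \sum_(a : word N k) f (enum_rank a).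
Proof.
rewrite (reindex_onto _ _ (fun i _ => enum_valK i)) /=.
by apply: eq_bigl => a; rewrite enum_rankK eqxx.
Qed.

Lemma entryM k (X Y : 'Op[A]_(N, k)) a b :
  entry (X *m Y) a b = \sum_c entry X a c * entry Y c b.
Proof. by rewrite /entry mxE sum_word. Qed.

Lemma entry_scalar k c (a b : word N k) :
  entry (c%:M : 'Op[A]_(N, k)) a b = c *+ (a == b).
Proof. by rewrite /entry mxE (inj_eq enum_rank_inj). Qed.

Lemma trace_entry k (X : 'Op[A]_(N, k)) : \tr X = \sum_a entry X a a.
Proof. by rewrite /mxtrace sum_word. Qed.

Lemma mulrn_mul (x y : A) (b c : bool) : x *+ b * (y *+ c) = (x * y) *+ (b && c).
Proof. by case: b; case: c; rewrite /= ?mulr0n ?mulr1n ?mul0r ?mulr0. Qed.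

End Entries.

Lemma entry_map (A B : pzRingType) (f : A -> B) N k (X : 'Op[A]_(N, k)) a b :
  entry (map_mx f X) a b = f (entry X a b).
Proof. by rewrite /entry mxE. Qed.

Section Legs.
Variables (A : pzRingType) (N : nat).

(** The letters of a word at the positions [f 0], ..., [f (m - 1)]. *)
Definition window m k (f : 'I_m -> 'I_k) (a : word N k) : word N m :=
  [ffun t => a (f t)].

(** The two words agree at all the other positions. *)
Definition same_off m k (f : 'I_m -> 'I_k) (a b : word N k) :=
  [forall j, (j \notin codom f) ==> (a j == b j)].

(** The word [a] with the letters at the positions [f 0], ..., [f (m - 1)]
    replaced by those of [d]. *)
Definition patch m k (f : 'I_m -> 'I_k) (a : word N k) (d : word N m) : word N k :=
  [ffun j => if [pick t | f t == j] is Some t then d t else a j].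

Lemma same_offP m k (f : 'I_m -> 'I_k) (a b : word N k) :
  reflect (forall j, (forall t, f t != j) -> a j = b j) (same_off f a b).
Proof.
apply: (iffP forallP) => H j.
  move=> Hj; apply/eqP/(implyP (H j)); apply/codomP=> -[t e].
  by have := Hj t; rewrite e eqxx.
apply/implyP=> jf; apply/eqP/H => t; apply: contraNneq jf => <-.
exact: codom_f.
Qed.

Lemma entry_legs m k (f : 'I_m -> 'I_k) (X : 'Op[A]_(N, m)) a b :
  entry (legs f X) a b = entry X (window f a) (window f b) *+ same_off f a b.
Proof. by rewrite entryE. Qed.

Section Inj.
Variables (m k : nat) (f : 'I_m -> 'I_k).
Hypothesis fI : injective f.

Lemma patch_in a d t : patch f a d (f t) = d t.
Proof.
rewrite ffunE; case: pickP => [u /eqP /fI -> //|/(_ t)].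
by rewrite eqxx.
Qed.

Lemma patch_off a d j : (forall t, f t != j) -> patch f a d j = a j.
Proof. by move=> H; rewrite ffunE; case: pickP => // t; rewrite (negPf (H t)). Qed.

Lemma window_patch a d : window f (patch f a d) = d.
Proof. by apply/ffunP => t; rewrite ffunE patch_in. Qed.

Lemma same_off_patch a d : same_off f a (patch f a d).
Proof. by apply/same_offP => j Hj; rewrite patch_off. Qed.

Lemma on_or_off j : (exists t, f t = j) \/ (forall t, f t != j).
Proof.
case: (pickP (fun t => f t == j)) => [t /eqP|H]; first by left; exists t.
by right=> t; rewrite H.
Qed.

Lemma patch_window a b : same_off f a b -> patch f a (window f b) = b.
Proof.
move/same_offP=> H; apply/ffunP=> j.
case: (on_or_off j) => [[t <-]|Hj]; first by rewrite patch_in ffunE.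
by rewrite patch_off // H.
Qed.

Lemma eq_word a b : same_off f a b -> (a == b) = (window f a == window f b).
Proof.
move=> H; apply/eqP/eqP => [-> //|e]; rewrite -(patch_window H) -e patch_window //.
by apply/same_offP.
Qed.

Lemma sum_same_off (F : word N k -> A) a :
  \sum_(c | same_off f a c) F c = \sum_d F (patch f a d).
Proof.
rewrite (reindex_onto (patch f a) (window f)) => [|c]; last exact: patch_window.
by apply: eq_bigl => d; rewrite same_off_patch window_patch eqxx.
Qed.

Lemma same_off_trans a b c : same_off f a b -> same_off f a c = same_off f b c.
Proof.
move/same_offP=> H; apply/same_offP/same_offP => H' j Hj; first by rewrite -H ?H'.
by rewrite H ?H'.
Qed.

Lemma legsM (X Y : 'Op[A]_(N, m)) : legs f (X *m Y) = legs f X *m legs f Y.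
Proof.
apply: entryP => a b; rewrite entry_legs !entryM -sumrMnl.
transitivity (\sum_(c | same_off f a c)
    (entry X (window f a) (window f c) * entry Y (window f c) (window f b))
    *+ same_off f a b).
  by rewrite sum_same_off; apply: eq_bigr => d _; rewrite window_patch.
rewrite big_mkcond; apply: eq_bigr => c _; rewrite !entry_legs mulrn_mul.
by case: ifP => // ac; rewrite (same_off_trans b ac).
Qed.

Lemma legs_scalar (c : A) : legs f (c%:M : 'Op[A]_(N, m)) = c%:M.
Proof.
apply: entryP => a b; rewrite entry_legs !entry_scalar.
case: (boolP (same_off f a b)) => [ab|]; first by rewrite mulr1n (eq_word ab).
move/negP; case: (a =P b) => [<-|_ _]; last by rewrite !mulr0n.
by case; apply/same_offP.
Qed.

End Inj.

Lemma legsD m k (f : 'I_m -> 'I_k) (X Y : 'Op[A]_(N, m)) :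
  legs f (X + Y) = legs f X + legs f Y.
Proof.
by apply: entryP => a b; rewrite /entry !mxE -mulrnDl /entry mxE.
Qed.

Lemma legsN m k (f : 'I_m -> 'I_k) (X : 'Op[A]_(N, m)) : legs f (- X) = - legs f X.
Proof. by apply: entryP => a b; rewrite /entry !mxE -mulNrn /entry mxE. Qed.

Lemma legs_ext m k (f g : 'I_m -> 'I_k) (X : 'Op[A]_(N, m)) :
  f =1 g -> legs f X = legs g X.
Proof.
move=> fg; apply: entryP => a b; rewrite !entry_legs; congr (entry _ _ _ *+ nat_of_bool _).
- by apply/ffunP=> t; rewrite !ffunE fg.
- by apply/ffunP=> t; rewrite !ffunE fg.
by apply/same_offP/same_offP => H j Hj; apply: H => t; rewrite ?fg // -fg.
Qed.

Lemma legs_legs m k l (f : 'I_m -> 'I_k) (g : 'I_k -> 'I_l) (X : 'Op[A]_(N, m)) :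
  injective g -> legs g (legs f X) = legs (g \o f) X.
Proof.
move=> gI; apply: entryP => a b; rewrite !entry_legs -mulrnA mulnb.
congr (entry _ _ _ *+ _); try by apply/ffunP=> t; rewrite !ffunE.
congr nat_of_bool; apply/andP/same_offP => [[/same_offP H1 /same_offP H2] j Hj|H].
  case: (on_or_off g j) => [[t e]|]; last exact: H2.
  have := H1 t; rewrite !ffunE e; apply=> u; apply: contraNneq (Hj u) => /= ->.
  by rewrite e.
split; apply/same_offP => j Hj; last by apply: H => t; exact: Hj.
by rewrite !ffunE; apply: H => t /=; rewrite (inj_eq gI).
Qed.

(** Operators in disjoint sets of tensor factors. *)
Lemma entry_legs_disjoint m1 m2 k (f : 'I_m1 -> 'I_k) (g : 'I_m2 -> 'I_k)
    (X : 'Op[A]_(N, m1)) (Y : 'Op[A]_(N, m2)) a b :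
  injective f -> injective g -> (forall t u, f t != g u) ->
  entry (legs f X *m legs g Y) a b =
    entry X (window f a) (window f b) * entry Y (window g a) (window g b)
    *+ [forall j, (j \notin codom f) ==> (j \notin codom g) ==> (a j == b j)].
Proof.
move=> fI gI fg; rewrite entryM.
set E := [forall j, _].
transitivity (\sum_(c | same_off f a c)
    (entry X (window f a) (window f c) * entry Y (window g c) (window g b))
    *+ same_off g c b).
  rewrite [RHS]big_mkcond; apply: eq_bigr => c _; rewrite !entry_legs mulrn_mul.
  by case: ifP.
rewrite sum_same_off //.
have wg d : window g (patch f a d) = window g a.
  by apply/ffunP=> u; rewrite !ffunE; case: pickP => // t; rewrite (negPf (fg _ _)).
under eq_bigr => d _ do rewrite window_patch // wg.
have EP : E -> same_off g (patch f a (window f b)) b.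
  move=> /forallP H; apply/same_offP => j Hj.
  case: (on_or_off f j) => [[t <-]|Hj']; first by rewrite patch_in // ffunE.
  rewrite patch_off //; apply/eqP.
  apply: (implyP (implyP (H j) _)); apply/codomP => -[t e].
    by have := Hj' t; rewrite e eqxx.
  by have := Hj t; rewrite e eqxx.
have PE d : same_off g (patch f a d) b -> d = window f b /\ E.
  move=> /same_offP H; split.
    apply/ffunP=> t; rewrite ffunE -H ?patch_in // => u; rewrite eq_sym; exact: fg.
  apply/forallP=> j; apply/implyP=> jf; apply/implyP=> jg; apply/eqP.
  rewrite -H => [|t]; last by apply: contraNneq jg => <-; exact: codom_f.
  by rewrite patch_off // => t; apply: contraNneq jf => <-; exact: codom_f.
rewrite (bigD1 (window f b)) //= big1 => [|d db]; last first.
  by case: (boolP (same_off _ _ _)) => // /PE[e]; rewrite e eqxx in db.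
rewrite addr0; congr (_ *+ nat_of_bool _); apply/idP/idP => [/PE[]|/EP] //.
Qed.

Lemma legs_disjoint_comm m1 m2 k (f : 'I_m1 -> 'I_k) (g : 'I_m2 -> 'I_k)
    (X : 'Op[A]_(N, m1)) (Y : 'Op[A]_(N, m2)) :
  injective f -> injective g -> (forall t u, f t != g u) ->
  (forall a b c d, entry X a b * entry Y c d = entry Y c d * entry X a b) ->
  legs f X *m legs g Y = legs g Y *m legs f X.
Proof.
move=> fI gI fg XY; apply: entryP => a b.
rewrite !entry_legs_disjoint //; last by move=> u t; rewrite eq_sym.
rewrite XY; congr (_ *+ nat_of_bool _); apply: eq_forallb => j.
by case: (j \in codom f); case: (j \in codom g).
Qed.

End Legs.

Lemma map_legs (A B : pzRingType) (f : {rmorphism A -> B}) N m k (g : 'I_m -> 'I_k)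
  (X : 'Op[A]_(N, m)) : map_mx f (legs g X) = legs g (map_mx f X).
Proof.
by apply: entryP => a b; rewrite entry_map !entry_legs rmorphMn /= entry_map.
Qed.

(** * The operators R_i *)

Section Act.
Variables (A : pzRingType) (N : nat).

(** The positions [i], ..., [i + m - 1], provided that they are at most [k]. *)
Definition shift m k (i : nat) (t : 'I_m) : 'I_k.+1 := inord (i + t).

Lemma shiftE m k i (t : 'I_m) : (i + m <= k.+1)%N -> @shift m k i t = (i + t)%N :> nat.
Proof.
move=> H; rewrite inordK //; apply: leq_trans H.
by rewrite -addnS leq_add2l.
Qed.

Lemma shift_inj m k i : (i + m <= k.+1)%N -> injective (@shift m k i).
Proof.
move=> H t u /(congr1 val) /=; rewrite !shiftE // => /addnI tu.
exact: val_inj.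
Qed.

Lemma shift_disjoint m1 m2 k i j : (i + m1 <= j)%N -> (j + m2 <= k.+1)%N ->
  forall t u, @shift m1 k i t != @shift m2 k j u.
Proof.
move=> H1 H2 t u; rewrite -val_eqE /= !shiftE //; last first.
  by apply: leq_trans H1 (leq_trans _ H2); apply: leq_addr.
rewrite neq_ltn; apply/orP; left; apply: leq_trans (leq_addr u j).
by apply: leq_trans H1; rewrite -addnS leq_add2l.
Qed.

Lemma actE m k i (X : 'Op[A]_(N, m)) : act k.+1 i X = legs (@shift m k i) X.
Proof. by []. Qed.

Lemma actM m k i (X Y : 'Op[A]_(N, m)) : (i + m <= k.+1)%N ->
  act k.+1 i (X * Y) = act k.+1 i X * act k.+1 i Y.
Proof. by move=> H; rewrite !actE -!mulmxE legsM //; apply: shift_inj. Qed.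

Lemma act_scalar m k i (c : A) : (i + m <= k.+1)%N ->
  act k.+1 i (c%:M : 'Op[A]_(N, m)) = c%:M.
Proof. by move=> H; rewrite actE legs_scalar //; apply: shift_inj. Qed.

Lemma actD m k i (X Y : 'Op[A]_(N, m)) :
  act k.+1 i (X + Y) = act k.+1 i X + act k.+1 i Y.
Proof. by rewrite !actE legsD. Qed.

Lemma actB m k i (X Y : 'Op[A]_(N, m)) :
  act k.+1 i (X - Y) = act k.+1 i X - act k.+1 i Y.
Proof. by rewrite actD; congr (_ + _); apply: legsN. Qed.

Lemma act_act m l k i j (X : 'Op[A]_(N, m)) :
  (j + m <= l.+1)%N -> (i + l.+1 <= k.+1)%N ->
  act k.+1 i (act l.+1 j X) = act k.+1 (i + j) X.
Proof.
move=> H1 H2; rewrite !actE legs_legs; last exact: shift_inj.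
apply: legs_ext => t; apply: val_inj; rewrite /= !shiftE ?addnA //.
by rewrite -addnA; apply: leq_trans H2; rewrite leq_add2l.
Qed.

Lemma act_id k (X : 'Op[A]_(N, k.+1)) : act k.+1 0 X = X.
Proof.
apply: entryP => a b; rewrite actE entry_legs.
have E c : window (@shift k.+1 k 0) c = c.
  by apply/ffunP=> t; rewrite ffunE; congr (c _); apply: val_inj; rewrite /= shiftE.
rewrite !E; case: same_offP => // -[] j /(_ j) /eqP[].
by apply: val_inj; rewrite /= shiftE.
Qed.

Lemma act_comm m1 m2 k i j (X : 'Op[A]_(N, m1)) (Y : 'Op[A]_(N, m2)) :
  (i + m1 <= j)%N -> (j + m2 <= k.+1)%N ->
  (forall a b c d, entry X a b * entry Y c d = entry Y c d * entry X a b) ->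
  act k.+1 i X * act k.+1 j Y = act k.+1 j Y * act k.+1 i X.
Proof.
move=> H1 H2 XY; rewrite !actE -!mulmxE; apply: legs_disjoint_comm => //.
- by apply: shift_inj; apply: leq_trans H1 (leq_trans (leq_addr _ _) H2).
- exact: shift_inj.
exact: shift_disjoint.
Qed.

End Act.

Lemma map_act (A B : pzRingType) (f : {rmorphism A -> B}) N m k i
  (X : 'Op[A]_(N, m)) : map_mx f (act k i X) = act k i (map_mx f X).
Proof. by case: k => [|k]; [rewrite /= map_mx1|rewrite !actE map_legs]. Qed.

Section HeckeOperators.
Variables (F : fieldType) (N : nat) (q : F) (R : 'Op[F]_(N, 2)).
Hypothesis HR : hecke_symmetry q R.

Lemma hecke_q0 : q != 0.
Proof. by case: HR; rewrite !inE !negb_or => /and3P[]. Qed.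

Lemma hecke_qq : q - q^-1 != 0.
Proof.
case: HR; rewrite !inE !negb_or => /and3P[q0 q1 qN1] _ _.
apply/eqP => e; have /eqP : (q - 1) * (q + 1) = 0.
  by rewrite -subr_sqr expr1n expr2 -(mulVf q0) -mulrBl e mul0r.
by rewrite mulf_eq0 subr_eq0 addr_eq0 (negPf q1) (negPf qN1).
Qed.

(** The Hecke relation gives the inverse of [R]. *)
Lemma hecke_inv : R * (R - (q - q^-1)%:M) = 1.
Proof.
have /eqP H : 1 + q%:M * R - (R * q^-1%:M + R * R) = 0.
  case: HR => _ _ <-; rewrite mulmxE mulrBl !mulrDr -(rmorphM scalar_mx) /=.
  by rewrite mulfV ?hecke_q0.
rewrite subr_eq0 in H; move/eqP in H.
have c : q%:M * R = R * q%:M by rewrite -!mulmxE scalar_mxC.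
rewrite (rmorphB scalar_mx) /= !mulrBr -c opprB addrA [R * R + _]addrC -H.
by rewrite addrK.
Qed.

Lemma hecke_unit : R \in unitmx.
Proof. by have /mulmx1_unit[] := hecke_inv. Qed.

Lemma act_inv k i : (i.+2 <= k.+1)%N ->
  act k.+1 i R * act k.+1 i (invmx R) = 1 /\ act k.+1 i (invmx R) * act k.+1 i R = 1.
Proof.
move=> lik; rewrite -addn2 in lik.
by rewrite -!actM // -!mulmxE mulmxV ?mulVmx ?hecke_unit // act_scalar.
Qed.

Lemma act_invmx k i : (i.+2 <= k.+1)%N -> invmx (act k.+1 i R) = act k.+1 i (invmx R).
Proof.
move=> lik; have [H H'] := act_inv lik.
have u : act k.+1 i R \in unitmx by have /mulmx1_unit[] := H.
by rewrite -[LHS]mulr1 -H mulrA -mulmxE mulVmx // mul1mx.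
Qed.

Lemma act_hecke k : hecke_relations q scalar_mx k.+1 (fun i => act k.+1 i R).
Proof.
case: HR => _ Hb Hh; split=> [i lik|i lik|i j lij ljk].
- have lik' : (i + 2 <= k.+1)%N by rewrite addn2.
  rewrite -!(@act_scalar _ _ 2 k i) // -actB -actD -actM // -mulmxE Hh.
  have -> : (0 : 'Op[F]_(N, 2)) = 0%:M by rewrite raddf0.
  by rewrite act_scalar ?raddf0.
- have H0 : act k.+1 i (act 3 0 R) = act k.+1 i R by rewrite act_act ?addn0 ?addn3.
  have H1 : act k.+1 i (act 3 1 R) = act k.+1 i.+1 R by rewrite act_act ?addn1 ?addn3.
  have := congr1 (act k.+1 i) Hb; rewrite !mulmxE !actM ?addn3 //.
  by rewrite H0 H1.
- by apply: act_comm; rewrite ?addn2 // => a b c d; rewrite mulrC.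
Qed.

End HeckeOperators.

(** * The matrix C commutes with R *)

Section SmallWords.
Variable N : nat.
Notation I := 'I_N.

(** The words with given letters. *)
Definition w1 (a : I) : word N 1 := [ffun=> a].
Definition w2 (a b : I) : word N 2 := [ffun t : 'I_2 => if val t == 0 then a else b].
Definition w3 (a b c : I) : word N 3 :=
  [ffun t : 'I_3 => if val t == 0 then a else if val t == 1 then b else c].

Lemma w1K (a : word N 1) : w1 (a ord0) = a.
Proof. by apply/ffunP=> t; rewrite ffunE (ord1 t). Qed.

Lemma w2K (a : word N 2) : w2 (a ord0) (a (inord 1)) = a.
Proof.
apply/ffunP=> t; rewrite ffunE; case: ifP => [/eqP|] H; congr (a _); apply: val_inj.
  by rewrite /= H.
by rewrite /= inordK //; case: t H => [[|[|]]].
Qed.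

Lemma w3K (a : word N 3) : w3 (a ord0) (a (inord 1)) (a (inord 2)) = a.
Proof.
apply/ffunP=> t; rewrite ffunE; case: ifP => [/eqP H|H].
  by congr (a _); apply: val_inj; rewrite /= H.
case: ifP => [/eqP H'|H']; congr (a _); apply: val_inj; rewrite /= inordK //.
by case: t H H' => [[|[|[|]]]].
Qed.

Lemma sum_w1 (V : nmodType) (f : word N 1 -> V) : \sum_a f a = \sum_x f (w1 x).
Proof.
rewrite (reindex_onto w1 (fun a : word N 1 => a ord0)) => [|a _]; last exact: w1K.
by apply: eq_bigl => x; rewrite ffunE eqxx.
Qed.

Lemma sum_w2 (V : nmodType) (f : word N 2 -> V) :
  \sum_a f a = \sum_x \sum_y f (w2 x y).
Proof.
rewrite pair_bigA /=.
rewrite (reindex_onto (fun p : I * I => w2 p.1 p.2)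
  (fun a : word N 2 => (a ord0, a (inord 1)))) => [|a _]; last exact: w2K.
by apply: eq_bigl => -[x y]; rewrite !ffunE /= inordK // eqxx.
Qed.

Lemma sum_w3 (V : nmodType) (f : word N 3 -> V) :
  \sum_a f a = \sum_x \sum_y \sum_z f (w3 x y z).
Proof.
rewrite pair_bigA /= pair_bigA /=.
rewrite (reindex_onto (fun p : I * I * I => w3 p.1.1 p.1.2 p.2)
  (fun a : word N 3 => (a ord0, a (inord 1), a (inord 2)))) => [|a _];
  last exact: w3K.
by apply: eq_bigl => -[[x y] z]; rewrite !ffunE /= !inordK // eqxx.
Qed.

Lemma w2_eq a b c d : (w2 a b == w2 c d) = (a == c) && (b == d).
Proof.
apply/eqP/andP => [/ffunP H|[/eqP-> /eqP->] //].
by have := H ord0; have := H (inord 1); rewrite !ffunE /= inordK //= => -> ->.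
Qed.

Lemma sum_delta (V : nmodType) (f : I -> V) a : \sum_x f x *+ (x == a) = f a.
Proof.
by rewrite (bigD1 a) //= eqxx big1 ?addr0 // => x /negPf->.
Qed.

Lemma sum_delta' (V : nmodType) (f : I -> V) a : \sum_x f x *+ (a == x) = f a.
Proof. by rewrite -[RHS]sum_delta; apply: eq_bigr => x _; rewrite eq_sym. Qed.

Lemma sum_delta2 (V : pzSemiRingType) (f : I -> I -> V) g h :
  \sum_x \sum_y f x y * ((g == x) && (y == h))%:R = f g h.
Proof.
rewrite (bigD1 g) //= [X in _ + X]big1 ?addr0 => [|x xg]; last first.
  by rewrite big1 // => y _; rewrite eq_sym (negPf xg) mulr0.
by rewrite eqxx; under eq_bigr => y _ do rewrite mulr_natr; rewrite sum_delta.
Qed.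

Section Acts.
Variable A : pzRingType.
Implicit Type X : 'Op[A]_(N, 2).

Lemma entry_act30 X a b c a' b' c' :
  entry (act 3 0 X) (w3 a b c) (w3 a' b' c') =
  entry X (w2 a b) (w2 a' b') *+ (c == c').
Proof.
have W x y z : window (@shift 2 2 0) (w3 x y z) = w2 x y.
  by apply/ffunP=> -[[|[|[]]] H] //; rewrite !ffunE /= inordK.
rewrite actE entry_legs !W; congr (_ *+ nat_of_bool _).
apply/same_offP/eqP => [/(_ (inord 2))|->].
  rewrite !ffunE /= inordK //= => -> // t.
  by rewrite -val_eqE /= shiftE // inordK //; case: t => [[|[|]]].
move=> -[[|[|[|[]]]] H] // Ht; rewrite !ffunE //=.
- by have := Ht (Ordinal (isT : 0 < 2)%N); rewrite -val_eqE /= shiftE.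
- by have := Ht (Ordinal (isT : 1 < 2)%N); rewrite -val_eqE /= shiftE.
Qed.

Lemma entry_act31 X a b c a' b' c' :
  entry (act 3 1 X) (w3 a b c) (w3 a' b' c') =
  entry X (w2 b c) (w2 b' c') *+ (a == a').
Proof.
have W x y z : window (@shift 2 2 1) (w3 x y z) = w2 y z.
  by apply/ffunP=> -[[|[|[]]] H] //; rewrite !ffunE /= inordK.
rewrite actE entry_legs !W; congr (_ *+ nat_of_bool _).
apply/same_offP/eqP => [/(_ ord0)|->].
  rewrite !ffunE /= => -> // t.
  by rewrite -val_eqE /= shiftE.
move=> -[[|[|[|[]]]] H] // Ht; rewrite !ffunE //=.
- by have := Ht (Ordinal (isT : 0 < 2)%N); rewrite -val_eqE /= shiftE.
- by have := Ht (Ordinal (isT : 1 < 2)%N); rewrite -val_eqE /= shiftE.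
Qed.

Lemma insert_w3 a x c : insert (inord 1) x (w2 a c) = w3 a x c.
Proof.
apply/ffunP=> t; rewrite !ffunE; case: unliftP => [j ->|->]; last by rewrite /= inordK.
by rewrite !ffunE /= /bump !inordK //; case: j => [[|[|]]].
Qed.

Lemma insert_w2 a x : insert (inord 1) x (w1 a) = w2 a x.
Proof.
apply/ffunP=> t; rewrite !ffunE; case: unliftP => [j ->|->]; last by rewrite /= inordK.
by rewrite !ffunE /= /bump inordK // (ord1 j).
Qed.

Lemma entry_act31_act30 (X Y : 'Op[A]_(N, 2)) a b z p x s :
  entry (act 3 1 X * act 3 0 Y) (w3 a b z) (w3 p x s) =
  \sum_v entry X (w2 b z) (w2 v s) * entry Y (w2 a v) (w2 p x).
Proof.
rewrite -mulmxE entryM sum_w3.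
rewrite (bigD1 a) //= [X in _ + X]big1 ?addr0 => [|u ua]; last first.
  rewrite big1 // => v _; rewrite big1 // => w _.
  by rewrite entry_act31 eq_sym (negPf ua) mul0r.
apply: eq_bigr => v _; rewrite (bigD1 s) //= [X in _ + X]big1 ?addr0 => [|w ws].
  by rewrite entry_act31 entry_act30 !eqxx.
by rewrite entry_act30 (negPf ws) mulr0.
Qed.

Lemma entry_act30_act31 (X Y : 'Op[A]_(N, 2)) a b z p x s :
  entry (act 3 0 X * act 3 1 Y) (w3 a b z) (w3 p x s) =
  \sum_v entry X (w2 a b) (w2 p v) * entry Y (w2 v z) (w2 x s).
Proof.
rewrite -mulmxE entryM sum_w3.
rewrite (bigD1 p) //= [X in _ + X]big1 ?addr0 => [|u up]; last first.
  rewrite big1 // => v _; rewrite big1 // => w _.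
  by rewrite entry_act31 (negPf up) mulr0.
apply: eq_bigr => v _; rewrite (bigD1 z) //= [X in _ + X]big1 ?addr0 => [|w wz].
  by rewrite entry_act31 entry_act30 !eqxx.
by rewrite entry_act30 eq_sym (negPf wz) mul0r.
Qed.

Lemma entry_act313 (X Y Z : 'Op[A]_(N, 2)) a b z a' b' z' :
  entry (act 3 1 X * act 3 0 Y * act 3 1 Z) (w3 a b z) (w3 a' b' z') =
  \sum_x \sum_s \sum_v entry X (w2 b z) (w2 v s) * entry Y (w2 a v) (w2 a' x)
                      * entry Z (w2 x s) (w2 b' z').
Proof.
rewrite -mulmxE entryM sum_w3.
rewrite (bigD1 a') //= [X in _ + X]big1 ?addr0 => [|u up]; last first.
  rewrite big1 // => v _; rewrite big1 // => w _.
  by rewrite entry_act31 (negPf up) mulr0.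
apply: eq_bigr => x _; apply: eq_bigr => s _.
by rewrite mulmxE entry_act31_act30 entry_act31 eqxx mulr1n mulr_suml.
Qed.

Lemma entry_act131 (X Y Z : 'Op[A]_(N, 2)) a b z a' b' z' :
  entry (act 3 0 X * act 3 1 Y * act 3 0 Z) (w3 a b z) (w3 a' b' z') =
  \sum_p \sum_x \sum_v entry X (w2 a b) (w2 p v) * entry Y (w2 v z) (w2 x z')
                      * entry Z (w2 p x) (w2 a' b').
Proof.
rewrite -mulmxE entryM sum_w3; apply: eq_bigr => p _; apply: eq_bigr => x _.
rewrite (bigD1 z') //= [X in _ + X]big1 ?addr0 => [|w wz]; last first.
  by rewrite entry_act30 (negPf wz) mulr0.
by rewrite mulmxE entry_act30_act31 entry_act30 eqxx mulr1n mulr_suml.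
Qed.

End Acts.
End SmallWords.

Section Sums.
Variables (F : comPzRingType) (I : finType).

Lemma sum2 (f : I -> I -> F) : \sum_x \sum_y f x y = \sum_(t : I * I) f t.1 t.2.
Proof. exact: pair_bigA. Qed.

Lemma sum3 (f : I -> I -> I -> F) :
  \sum_x \sum_y \sum_z f x y z = \sum_(t : I * I * I) f t.1.1 t.1.2 t.2.
Proof. by rewrite pair_bigA /= pair_bigA. Qed.

(** Exchanging the contractions over [s] and over [t]. *)
Lemma sum_pull (S T : finType) (c : T -> F) (f : S -> F) (g : S -> T -> F) :
  \sum_t c t * (\sum_s f s * g s t) = \sum_s f s * (\sum_t g s t * c t).
Proof.
under eq_bigr => t _ do rewrite mulr_sumr.
rewrite exchange_big; apply: eq_bigr => s _; rewrite mulr_sumr.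
by apply: eq_bigr => t _; rewrite mulrCA (mulrC (c t)).
Qed.

End Sums.

Section SkewInverse.
Variables (F : fieldType) (N : nat) (q : F) (R Psi : 'Op[F]_(N, 2)).
Hypothesis HR : hecke_symmetry q R.
Hypothesis HPsi : skew_inverse R Psi.
Notation I := 'I_N.

Local Notation RI := (invmx R).
(** The entry of [X] in the row [(a, b)] and the column [(c, d)]. *)
Local Notation "X # a b ; c d" := (entry X (w2 a b) (w2 c d))
  (at level 8, a, b, c, d at level 1).
Local Notation C := (fun a c : I => entry (qtrace_mx Psi) (w1 a) (w1 c)).

Lemma qtrace_mxE a c : C a c = \sum_x Psi # a x ; c x.
Proof. by rewrite /qtrace_mx /ptrace entryE; apply: eq_bigr => x _; rewrite !insert_w2. Qed.

Lemma skew_inverse1 a e c f :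
  \sum_x \sum_y R # a x ; c y * Psi # y e ; x f = ((a == f) && (e == c))%:R.
Proof.
have [H _] := HPsi.
transitivity (entry (flip F N) (w2 a e) (w2 c f)); last first.
  by rewrite /flip entryE !ffunE.
rewrite -H /ptrace entryE; apply: eq_bigr => x _; rewrite !insert_w3.
by rewrite mulmxE entry_act30_act31.
Qed.

Lemma skew_inverse2 a e c f :
  \sum_x \sum_y Psi # a x ; c y * R # y e ; x f = ((a == f) && (e == c))%:R.
Proof.
have [_ H] := HPsi.
transitivity (entry (flip F N) (w2 a e) (w2 c f)); last first.
  by rewrite /flip entryE !ffunE.
rewrite -H /ptrace entryE; apply: eq_bigr => x _; rewrite !insert_w3.
by rewrite mulmxE entry_act30_act31.
Qed.

(** [Tr_(2) (C_2 R_12) = I_1]. *)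
Lemma qtrace_R a c : \sum_x \sum_y R # a x ; c y * C y x = (a == c)%:R.
Proof.
under eq_bigr => x _ do under eq_bigr => y _ do rewrite qtrace_mxE mulr_sumr.
under eq_bigr => x _ do rewrite exchange_big /=.
rewrite exchange_big /=; under eq_bigr => e _ do rewrite skew_inverse1.
rewrite (bigD1 a) //= eqxx big1 ?addr0 // => e ea.
by rewrite eq_sym (negPf ea).
Qed.

(** The trace over the third factor of [C_3 P_23 R_12 P'_23 = C_3 P'_12 R_23 P_12] is
    the identity, by [qtrace_R]. *)
Lemma conj_trace_free (P P' : 'Op[F]_(N, 2)) a b a' b' : P' * P = 1 ->
  act 3 1 P * act 3 0 R * act 3 1 P' = act 3 0 P' * act 3 1 R * act 3 0 P ->
  \sum_z \sum_z' C z' z *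
    entry (act 3 1 P * act 3 0 R * act 3 1 P') (w3 a b z) (w3 a' b' z') =
  ((a == a') && (b == b'))%:R.
Proof.
move=> PP E; rewrite sum2.
under eq_bigr => t _ do rewrite E entry_act131 sum3.
transitivity (\sum_(t : I * I) C t.2 t.1 * \sum_(s : I * I * I)
  (P' # a b ; s.1.1 s.2 * P # s.1.1 s.1.2 ; a' b') * R # s.2 t.1 ; s.1.2 t.2).
  by apply: eq_bigr => t _; congr (_ * _); apply: eq_bigr => s _; rewrite mulrAC.
rewrite sum_pull.
under eq_bigr => s _ do
  rewrite -(sum2 (fun z z' => R # s.2 z ; s.1.2 z' * C z' z)) qtrace_R.
rewrite -(sum3 (fun p x v => P' # a b ; p v * P # p x ; a' b' * (v == x)%:R)).
transitivity (entry (P' * P) (w2 a b) (w2 a' b')); last first.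
  by rewrite PP entry_scalar w2_eq.
rewrite -mulmxE entryM sum_w2; apply: eq_bigr => p _; apply: eq_bigr => x _.
by under eq_bigr => v _ do rewrite mulr_natr; rewrite sum_delta.
Qed.

(** For all [Y], [Tr_(2) (C_2 P_12 Y_1 P'_12) = Tr (C Y) I_1]; here [Y] is a matrix
    unit. The skew inverse contracts the first factor of [conj_trace_free], which
    replaces [R_12] by an arbitrary [Y_2]. *)
Lemma conj_trace (P P' : 'Op[F]_(N, 2)) b f e b' : P' * P = 1 ->
  act 3 1 P * act 3 0 R * act 3 1 P' = act 3 0 P' * act 3 1 R * act 3 0 P ->
  \sum_z \sum_z' \sum_z1 C z' z * P # b z ; f z1 * P' # e z1 ; b' z' =
  C e f *+ (b == b').
Proof.
move=> PP E.
transitivity (\sum_(u : I * I) Psi # e u.2 ; f u.1 * \sum_(t : I * I) C t.2 t.1 *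
    entry (act 3 1 P * act 3 0 R * act 3 1 P') (w3 u.1 b t.1) (w3 u.2 b' t.2)).
  pose B (s : I * I * I) := \sum_(t : I * I)
    P # b t.1 ; s.2 s.1.2 * P' # s.1.1 s.1.2 ; b' t.2 * C t.2 t.1.
  transitivity (\sum_(u : I * I) Psi # e u.2 ; f u.1 * \sum_(s : I * I * I)
      B s * R # u.1 s.2 ; u.2 s.1.1); last first.
    apply: eq_bigr => u _; congr (_ * _).
    under [RHS]eq_bigr => t _ do rewrite entry_act313 sum3.
    transitivity (\sum_(t : I * I) C t.2 t.1 * \sum_(s : I * I * I)
        R # u.1 s.2 ; u.2 s.1.1 * (P # b t.1 ; s.2 s.1.2 * P' # s.1.1 s.1.2 ; b' t.2)).
      by rewrite sum_pull; apply: eq_bigr => s _; rewrite mulrC.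
    apply: eq_bigr => t _; congr (_ * _); apply: eq_bigr => s _.
    by rewrite mulrA; congr (_ * _); rewrite mulrC.
  rewrite sum_pull.
  transitivity (\sum_(s : I * I * I) B s * ((e == s.1.1) && (s.2 == f))%:R); last first.
    apply: eq_bigr => s _; congr (_ * _); rewrite -skew_inverse2 exchange_big sum2.
    by apply: eq_bigr => u _; rewrite mulrC.
  rewrite -(sum3 (fun x s v => B (x, s, v) * ((e == x) && (v == f))%:R)).
  rewrite [RHS](bigD1 e) //= [X in _ + X]big1 ?addr0 => [|x xe]; last first.
    by rewrite big1 // => s _; rewrite big1 // => v _; rewrite eq_sym (negPf xe) mulr0.
  under [RHS]eq_bigr => s _ do under eq_bigr => v _ do rewrite eqxx mulr_natr.
  under [RHS]eq_bigr => s _ do rewrite sum_delta /B /=.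
  rewrite sum2 exchange_big; apply: eq_bigr => t _; apply: eq_bigr => s _.
  by rewrite [RHS]mulrC mulrA.
under eq_bigr => u _ do rewrite -(sum2 (fun z z' => C z' z *
  entry _ (w3 u.1 b z) (w3 u.2 b' z'))) conj_trace_free //.
rewrite -(sum2 (fun a a' => Psi # e a' ; f a * ((a == a') && (b == b'))%:R)).
rewrite qtrace_mxE -sumrMnl; apply: eq_bigr => a _.
rewrite -[RHS]mulr_natr -[RHS](sum_delta' (fun a' => Psi # e a' ; f a * (b == b')%:R)).
by apply: eq_bigr => a' _; rewrite -mulnb natrM mulrCA mulr_natl.
Qed.

(** The two forms of the braid relation to which [conj_trace] applies. *)
Lemma conj_braid :
  act 3 1 R * act 3 0 R * act 3 1 RI = act 3 0 RI * act 3 1 R * act 3 0 R /\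
  act 3 1 RI * act 3 0 R * act 3 1 R = act 3 0 R * act 3 1 R * act 3 0 RI.
Proof.
case: (HR) => _ Hb _; rewrite /braiding !mulmxE in Hb.
have [a a'] := @act_inv _ _ _ _ HR 2 0 isT.
have [b b'] := @act_inv _ _ _ _ HR 2 1 isT.
move: (act 3 0 R) (act 3 1 R) (act 3 0 RI) (act 3 1 RI) Hb a a' b b'.
move=> x y x' y' Hb a a' b b'; split.
  transitivity (x' * (x * y * x) * y'); first by rewrite !mulrA a' mul1r.
  by rewrite Hb -!mulrA b mulr1 !mulrA.
transitivity (y' * (x * y * x) * x'); last by rewrite Hb !mulrA b' mul1r.
by rewrite -!mulrA a mulr1 !mulrA.
Qed.

(** [R^(-1) C_2 = C_1 Psi_21]. *)
Lemma RI_C e g b' h :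
  \sum_z RI # e g ; b' z * C z h = \sum_f C e f * Psi # g f ; h b'.
Proof.
have PP : RI * R = 1 by rewrite -mulmxE mulVmx // (hecke_unit HR).
have E := fun b f => conj_trace b f e b' PP (proj1 conj_braid).
transitivity (\sum_(u : I * I) Psi # g u.1 ; h u.2 * (C e u.1 *+ (u.2 == b'))); last first.
  rewrite -(sum2 (fun f b => Psi # g f ; h b * (C e f *+ (b == b')))).
  apply: eq_bigr => f _; under eq_bigr => b _ do rewrite mulrnAr.
  by rewrite sum_delta mulrC.
transitivity (\sum_(u : I * I) Psi # g u.1 ; h u.2 * \sum_(s : I * I * I)
   (C s.1.2 s.1.1 * RI # e s.2 ; b' s.1.2) * R # u.2 s.1.1 ; u.1 s.2); last first.
  apply: eq_bigr => u _; congr (_ * _); rewrite -E sum3.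
  by apply: eq_bigr => s _; rewrite mulrAC.
rewrite sum_pull.
transitivity (\sum_(s : I * I * I) C s.1.2 s.1.1 * RI # e s.2 ; b' s.1.2
    * ((g == s.2) && (s.1.1 == h))%:R); last first.
  apply: eq_bigr => s _; congr (_ * _); rewrite -skew_inverse2 sum2.
  by apply: eq_bigr => u _; rewrite mulrC.
rewrite -(sum3 (fun z z' z1 => C z' z * RI # e z1 ; b' z' * ((g == z1) && (z == h))%:R)).
rewrite exchange_big; apply: eq_bigr => z' _ /=; rewrite exchange_big /=.
by rewrite (sum_delta2 (fun z1 z => C z' z * RI # e z1 ; b' z')) mulrC.
Qed.

(** [C_2 R^(-1) = Psi_21 C_1]. *)
Lemma C_RI g b f h :
  \sum_z C g z * RI # b z ; f h = \sum_e Psi # g b ; h e * C e f.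
Proof.
have PP : R * RI = 1 by rewrite -mulmxE mulmxV // (hecke_unit HR).
have E := fun e b' => conj_trace b f e b' PP (proj2 conj_braid).
transitivity (\sum_(u : I * I) Psi # g u.1 ; h u.2 * (C u.2 f *+ (b == u.1))); last first.
  rewrite -(sum2 (fun b' e => Psi # g b' ; h e * (C e f *+ (b == b')))) exchange_big.
  apply: eq_bigr => e _; under eq_bigr => b' _ do rewrite mulrnAr.
  by rewrite sum_delta'.
transitivity (\sum_(u : I * I) Psi # g u.1 ; h u.2 * \sum_(s : I * I * I)
   (C s.1.2 s.1.1 * RI # b s.1.1 ; f s.2) * R # u.2 s.2 ; u.1 s.1.2); last first.
  by apply: eq_bigr => u _; congr (_ * _); rewrite -E sum3.
rewrite sum_pull.
transitivity (\sum_(s : I * I * I) C s.1.2 s.1.1 * RI # b s.1.1 ; f s.2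
    * ((g == s.1.2) && (s.2 == h))%:R); last first.
  apply: eq_bigr => s _; congr (_ * _); rewrite -skew_inverse2 sum2.
  by apply: eq_bigr => u _; rewrite mulrC.
rewrite -(sum3 (fun z z' z1 => C z' z * RI # b z ; f z1 * ((g == z') && (z1 == h))%:R)).
apply: eq_bigr => z _.
by rewrite (sum_delta2 (fun z' z1 => C z' z * RI # b z ; f z1)).
Qed.

Lemma entry_CC a b c d :
  entry (act 2 0 (qtrace_mx Psi) * act 2 1 (qtrace_mx Psi)) (w2 a b) (w2 c d) =
  C a c * C b d.
Proof.
rewrite -mulmxE !actE entry_legs_disjoint; first last.
- exact: shift_disjoint.
- exact: shift_inj.
- exact: shift_inj.
have W0 x y : window (@shift 1 1 0) (w2 x y) = w1 x.
  by apply/ffunP=> t; rewrite !ffunE /= inordK (ord1 t).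
have W1 x y : window (@shift 1 1 1) (w2 x y) = w1 y.
  by apply/ffunP=> t; rewrite !ffunE /= inordK (ord1 t).
rewrite !W0 !W1; set E := [forall j, _]; suff -> : E by [].
apply/forallP=> -[[|[|]] // H]; apply/implyP.
  by case/codomP; exists ord0; apply: val_inj; rewrite /= shiftE.
move=> _; apply/implyP; case/codomP.
by exists ord0; apply: val_inj; rewrite /= shiftE.
Qed.

(** [C_1 C_2] commutes with [R]; this makes the quantum trace cyclic with respect to
    the operators [R_i]. *)
Lemma qtrace_mx_comm :
  GRing.comm (act 2 0 (qtrace_mx Psi) * act 2 1 (qtrace_mx Psi)) R.
Proof.
suff : GRing.comm (act 2 0 (qtrace_mx Psi) * act 2 1 (qtrace_mx Psi)) RI.
  set X := _ * _ => XR; have RR := hecke_unit HR.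
  have e1 : R * RI = 1 by rewrite -mulmxE mulmxV.
  have e2 : RI * R = 1 by rewrite -mulmxE mulVmx.
  by rewrite /GRing.comm -[LHS]mul1r -e1 -mulrA (mulrA RI) -XR -!mulrA e2 mulr1.
apply: entryP => x y; rewrite -(w2K x) -(w2K y).
move: (x ord0) (x (inord 1)) (y ord0) (y (inord 1)) => a b c d {x y}.
rewrite -!mulmxE !entryM !sum_w2 mulmxE.
transitivity (\sum_a1 \sum_e C a a1 * Psi # b a1 ; d e * C e c).
  apply: eq_bigr => a1 _; under [RHS]eq_bigr => e _ do rewrite -mulrA.
  rewrite -mulr_sumr -C_RI mulr_sumr.
  by apply: eq_bigr => b1 _; rewrite entry_CC -mulrA.
rewrite exchange_big; apply: eq_bigr => e _ /=.
rewrite -mulr_suml -RI_C mulr_suml.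
by apply: eq_bigr => z _; rewrite entry_CC -mulrA (mulrC (C z d)).
Qed.

End SkewInverse.

(** * Traces over the last factor *)

Section PartialTrace.
Variables (F : comPzRingType) (N : nat).
Notation I := 'I_N.

Lemma sum_insert (V : nmodType) k (f : word N k.+1 -> V) :
  \sum_a f a = \sum_(a : word N k) \sum_x f (insert ord_max x a).
Proof.
rewrite pair_bigA /=.
rewrite (reindex_onto (fun p : word N k * I => insert ord_max p.2 p.1)
  (fun a : word N k.+1 => ([ffun j => a (lift ord_max j)], a ord_max))).
  apply: eq_bigl => -[a x] /=; rewrite xpair_eqE; apply/andP; split; apply/eqP.
    by apply/ffunP=> j; rewrite !ffunE liftK.
  by rewrite ffunE unlift_none.
move=> a _; apply/ffunP=> j; rewrite ffunE.
by case: unliftP => [j' ->|->] //=; rewrite ffunE.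
Qed.

Lemma insert_last k x (a : word N k) : insert ord_max x a ord_max = x.
Proof. by rewrite ffunE unlift_none. Qed.

Lemma insert_lt k x (a : word N k) (j : 'I_k) (t : 'I_k.+1) :
  t = j :> nat -> insert ord_max x a t = a j.
Proof.
move=> tj; have -> : t = lift ord_max j by apply: ord_inj; rewrite lift_max.
by rewrite ffunE liftK.
Qed.

Lemma insert_last1 k x (a : word N k.+1) (t : 'I_k.+2) :
  t = k.+1 :> nat -> insert ord_max x a t = x.
Proof.
move=> tk; rewrite -[RHS](insert_last x a); congr (insert _ _ _ _).
exact: val_inj.
Qed.

(** The trace over the last factor of [(B (x) I) (I (x) G)] is [B (I (x) Tr_(2) G)];
    here it is traced over the other factors as well. *)
Lemma trace_last k (B : 'Op[F]_(N, k.+1)) (G : 'Op[F]_(N, 2)) :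
  \tr (act k.+2 0 B * act k.+2 k G) = \tr (B * act k.+1 k (ptrace (inord 1) G)).
Proof.
have W2 (a : word N k.+1) x :
    window (@shift 2 k.+1 k) (insert ord_max x a) = w2 (a ord_max) x.
  apply/ffunP=> -[[|[|]] // H]; rewrite [LHS]ffunE [RHS]ffunE /=.
    by apply: insert_lt; rewrite shiftE ?addn0 //= addn2.
  by apply: insert_last1; rewrite shiftE ?addn2 //= addn1.
have W1 (a : word N k.+1) : window (@shift 1 k k) a = w1 (a ord_max).
  apply/ffunP=> t; rewrite !ffunE; congr (a _); apply: ord_inj.
  by rewrite shiftE ?addn1 // (ord1 t) addn0.
have W0 (a : word N k.+1) x : window (@shift k.+1 k.+1 0) (insert ord_max x a) = a.
  by apply/ffunP=> t; rewrite ffunE; apply: insert_lt; rewrite shiftE.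
have O0 (a b : word N k.+1) x y :
    same_off (@shift k.+1 k.+1 0) (insert ord_max x a) (insert ord_max y b) = (x == y).
  apply/same_offP/eqP => [/(_ ord_max)|->].
    rewrite !insert_last => -> // t; rewrite -val_eqE /= shiftE // add0n.
    by rewrite neq_ltn ltn_ord.
  move=> j Hj; suff -> : j = ord_max by rewrite !insert_last.
  apply: val_inj => /=; apply/eqP; rewrite eqn_leq -ltnS ltn_ord /= leqNgt.
  apply/negP => jk; have := Hj (Ordinal jk).
  by rewrite -val_eqE /= shiftE ?eqxx.
have O2 (a b : word N k.+1) x y :
    same_off (@shift 2 k.+1 k) (insert ord_max x a) (insert ord_max y b)
    = same_off (@shift 1 k k) a b.
  apply/same_offP/same_offP => H j Hj.
    have := H (widen_ord (leqnSn _) j); rewrite !(@insert_lt _ _ _ j) //; apply=> t.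
    have := Hj ord0; rewrite -!val_eqE /= !shiftE ?addn1 ?addn2 // addn0.
    case: t => [[|[|]]] //= _; rewrite ?addn0 // => _.
    by rewrite addn1 eq_sym neq_ltn ltn_ord.
  have := Hj ord0; have := Hj (Ordinal (isT : 1 < 2)%N).
  rewrite -!val_eqE /= !shiftE ?addn2 //= addn1 addn0 => j1 j0.
  have jk : (j < k.+1)%N by have := ltn_ord j; rewrite ltnS leq_eqVlt eq_sym (negPf j1).
  rewrite !(@insert_lt _ _ _ (Ordinal jk)) //; apply: H => t.
  by rewrite -val_eqE /= shiftE ?addn1 // (ord1 t) addn0.
rewrite !trace_entry sum_insert; apply: eq_bigr => a _.
under eq_bigr => x _ do rewrite -mulmxE entryM sum_insert.
rewrite -mulmxE entryM exchange_big; apply: eq_bigr => b _.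
have pG u v : entry (ptrace (inord 1) G) (w1 u) (w1 v) =
    \sum_x entry G (w2 u x) (w2 v x).
  by rewrite /ptrace entryE; apply: eq_bigr => x _; rewrite !insert_w2.
rewrite actE entry_legs !W1 pG.
rewrite mulrnAr mulr_sumr -sumrMnl; apply: eq_bigr => x _.
rewrite (bigD1 x) //= big1 ?addr0 => [|y yx]; last first.
  by rewrite entry_legs O0 eq_sym (negPf yx) mul0r.
by rewrite !entry_legs O0 eqxx !W0 !W2 O2 mulr1n mulrnAr.
Qed.

End PartialTrace.

(** * Quantum traces of the skew-symmetrizers *)

Lemma mx_trC (A : comPzRingType) n (X Y : 'M[A]_n) : \tr (X * Y) = \tr (Y * X).
Proof. exact: mxtrace_mulC. Qed.

(** A rank-one matrix [A = u v] compresses every matrix to a multiple of itself. *)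
Lemma rank1_sandwich (F : fieldType) (Q : pzRingType) (s : {rmorphism F -> Q})
    (sC : central_scalars s) n (A : 'M[F]_n) (X : 'M[Q]_n) : \rank A = 1%N ->
  map_mx s A * X * map_mx s A = (\tr (map_mx s A * X))%:M * map_mx s A.
Proof.
move: (col_base A) (row_base A) (mulmx_base A) => + + + rk.
rewrite rk => u v <-; rewrite map_mxM -!mulmxE.
set U := map_mx s u; set V := map_mx s v.
have Uc i x : U i ord0 * x = x * U i ord0 by rewrite mxE sC.
have -> : U *m V *m X *m (U *m V) = U *m (V *m X *m U) *m V by rewrite !mulmxA.
have -> : \tr (U *m V *m X) = (V *m X *m U) ord0 ord0.
  rewrite [RHS]mxE -mulmxA; apply: eq_bigr => i _.
  by rewrite mxE big_ord1 Uc.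
rewrite mul_scalar_mx; move: (V *m X *m U) => W; apply/matrixP=> i j.
rewrite [LHS]mxE big_ord1 [X in X * _]mxE big_ord1 Uc.
by rewrite [RHS]mxE [X in _ = _ * X]mxE big_ord1 mulrA.
Qed.

Section QuantumTrace.
Variables (F : fieldType) (N : nat) (q : F) (R Psi : 'Op[F]_(N, 2)).
Hypothesis HR : hecke_symmetry q R.
Hypothesis HPsi : skew_inverse R Psi.
Hypothesis qn : forall k, (0 < k)%N -> qint q k != 0.
Local Notation C := (qtrace_mx Psi).
Local Notation skew := (skew_symmetrizer q R).
Let q0 := hecke_q0 HR.
Let qq := hecke_qq HR.

Lemma scalar_mx_central k : central_scalars (@scalar_mx F k).
Proof. by move=> c x; rewrite -mulmxE scalar_mxC. Qed.

Lemma scale_scalar k c (X : 'M[F]_k) : c *: X = c%:M * X.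
Proof. by rewrite -mulmxE mul_scalar_mx. Qed.

Lemma skewE j : skew j.+2 = (qint q j.+2)^-1%:M *
  (act j.+2 0 (skew j.+1) * ((q ^+ j.+1)%:M - (qint q j.+1)%:M * act j.+2 j R)
   * act j.+2 0 (skew j.+1)).
Proof. by rewrite -!scale_scalar -!mulmxE. Qed.

Lemma act_skew k j : (j <= k.+1)%N ->
  act k.+1 0 (skew j) = asym q scalar_mx (fun i => act k.+1 i R) j.
Proof.
elim: j => [|[|j] IH] ljk; [exact: act_scalar..|].
rewrite asymE -(IH (ltnW ljk)) skewE.
rewrite !actM ?add0n // !act_scalar // actB act_scalar // actM // act_scalar //.
by rewrite !act_act ?addn2.
Qed.

Lemma skew_asym k : skew k.+1 = asym q scalar_mx (fun i => act k.+1 i R) k.+1.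
Proof. by rewrite -act_skew // act_id. Qed.

Lemma skew_idem k : skew k.+1 * skew k.+1 = skew k.+1.
Proof.
have sC : central_scalars (@scalar_mx F #|{: word N k.+1}|).
  exact: scalar_mx_central.
rewrite skew_asym.
exact: (asym_idem qq qn sC (act_hecke HR k)).
Qed.

(** [C_1 ... C_k]. *)
Definition Cprod k : 'Op[F]_(N, k) := \prod_(i < k) act k i C.

Lemma CprodS k : Cprod k.+2 = act k.+2 0 (Cprod k.+1) * act k.+2 k.+1 C.
Proof.
rewrite {1}/Cprod big_ord_recr; congr (_ * _).
have -> : act k.+2 0 (Cprod k.+1) =
  \prod_(i < k.+1) act k.+2 0 (act k.+1 i C).
  apply: (big_morph (fun X : 'Op[F]_(N, k.+1) => act k.+2 0 X)) => [X Y|].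
    by rewrite actM.
  exact: act_scalar.
by apply: eq_bigr => i _; rewrite act_act ?addn1.
Qed.

Lemma entry_act21 a x b y : entry (act 2 1 C) (w2 a x) (w2 b y) =
  entry C (w1 x) (w1 y) *+ (a == b).
Proof.
rewrite actE entry_legs.
have W1 u v : window (@shift 1 1 1) (w2 u v) = w1 v :> word N 1.
  by apply/ffunP=> t; rewrite !ffunE /= inordK (ord1 t).
rewrite !W1; congr (_ *+ nat_of_bool _).
apply/same_offP/eqP => [/(_ ord0)|->].
  by rewrite !ffunE /= => -> // t; rewrite -val_eqE /= shiftE.
move=> [[|[|]] // H] Ht; rewrite !ffunE //=.
by have := Ht ord0; rewrite -val_eqE /= shiftE.
Qed.

Lemma w1_eq (a b : 'I_N) : (w1 a == w1 b) = (a == b).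
Proof. by apply/eqP/eqP => [/ffunP/(_ ord0)|->] //; rewrite !ffunE. Qed.

Lemma ptrace_C : ptrace (inord 1) (act 2 1 C) = (\tr C)%:M.
Proof.
apply: entryP => a b; rewrite -(w1K a) -(w1K b) /ptrace entryE entry_scalar w1_eq.
rewrite trace_entry sum_w1 -sumrMnl; apply: eq_bigr => x _.
by rewrite !insert_w2 entry_act21.
Qed.

Lemma ptrace_CR : ptrace (inord 1) (act 2 1 C * R) = 1.
Proof.
apply: entryP => a b; rewrite -(w1K a) -(w1K b) /ptrace entryE entry_scalar.
move: (a ord0) (b ord0) => {a b} a b.
rewrite w1_eq -(qtrace_R HPsi) exchange_big; apply: eq_bigr => x _.
rewrite !insert_w2 -mulmxE entryM sum_w2.
rewrite (bigD1 a) //= [X in _ + X]big1 ?addr0 => [|u ua]; last first.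
  by rewrite big1 // => v _; rewrite entry_act21 eq_sym (negPf ua) mul0r.
by apply: eq_bigr => v _; rewrite entry_act21 eqxx mulr1n mulrC.
Qed.

Lemma ptraceB a b (X Y : 'Op[F]_(N, 2)) i :
  ptrace i (a *: X - b *: Y) = a *: ptrace i X - b *: ptrace i Y.
Proof.
apply/matrixP=> u v; rewrite !mxE !mulr_sumr -sumrB.
by apply: eq_bigr => x _; rewrite /entry !mxE.
Qed.

(** The quantum trace of a skew-symmetrizer over its last factor is a multiple of
    the preceding one; here it is paired with an arbitrary operator [X]. *)
Lemma trace_skewS k (X : 'Op[F]_(N, k.+1)) :
  qint q k.+2 * \tr (act k.+2 0 X * act k.+2 k.+1 C * skew k.+2) =
  (q ^+ k.+1 * \tr C - qint q k.+1) * \tr (X * skew k.+1).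
Proof.
pose B := act k.+2 0 (skew k.+1); pose C' := act k.+2 k.+1 C.
pose h := (q ^+ k.+1)%:M - (qint q k.+1)%:M * act k.+2 k R.
have Bc : C' * B = B * C'.
  by apply/esym/act_comm; rewrite ?addn1 // => *; rewrite mulrC.
have -> : \tr (act k.+2 0 X * C' * skew k.+2) =
    (qint q k.+2)^-1 * \tr (act k.+2 0 X * C' * (B * h * B)).
  rewrite skewE -mxtraceZ scale_scalar; congr (\tr _).
  rewrite -/B -/h; set Y := act k.+2 0 X * C'; set Z := B * h * B.
  by rewrite [LHS]mulrA -scalar_mx_central [RHS]mulrA.
rewrite mulVKf; last exact: qn.
have -> : \tr (act k.+2 0 X * C' * (B * h * B)) =
    \tr (act k.+2 0 (skew k.+1 * X * skew k.+1) * (C' * h)).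
  have -> : act k.+2 0 (skew k.+1 * X * skew k.+1) = B * act k.+2 0 X * B.
    by rewrite !actM.
  move: (act k.+2 0 X) B C' h Bc => X' B C' h Bc.
  by rewrite (mulrA (X' * C')) mx_trC !mulrA -(mulrA (B * X')) -Bc !mulrA.
have -> : C' * h = act k.+2 k (q ^+ k.+1 *: act 2 1 C - qint q k.+1 *: (act 2 1 C * R)).
  rewrite !scale_scalar actB !actM ?addn2 // !act_scalar ?addn2 //.
  rewrite act_act ?addn1 ?addn2 // mulrBr -scalar_mx_central !mulrA.
  by rewrite -scalar_mx_central.
rewrite trace_last ptraceB ptrace_C ptrace_CR !scale_scalar mulr1.
rewrite -(rmorphM scalar_mx) -(rmorphB scalar_mx) act_scalar ?addn1 //.
rewrite -scalar_mx_central -scale_scalar mxtraceZ; congr (_ * _).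
by rewrite mx_trC mulrA skew_idem mx_trC.
Qed.

Lemma Cprod1 : Cprod 1 = C.
Proof. by rewrite /Cprod big_ord_recl big_ord0 mulr1 act_id. Qed.

Section GLType.
Hypothesis rk1 : \rank (skew N) = 1%N.
Hypothesis skN : skew N.+1 = 0.
Hypothesis N0 : (0 < N)%N.

Lemma trace_skewN : \tr (skew N) = 1.
Proof.
have sN0 : skew N != 0 by apply/eqP => e; move: rk1; rewrite e mxrank0.
have id : skew N * skew N = skew N.
  have H k : (0 < k)%N -> skew k * skew k = skew k by case: k => // k _; exact: skew_idem.
  exact: H.
have sC : central_scalars (idfun : F -> F) by move=> c x; rewrite mulrC.
have := rank1_sandwich sC 1 rk1; rewrite !map_mx_id // mulr1 id => e.
apply/eqP; rewrite -subr_eq0.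
have /eqP : (\tr (skew N) - 1) *: skew N = 0.
  by rewrite scalerBl scale1r scale_scalar -e subrr.
by rewrite scaler_eq0 (negPf sN0) orbF.
Qed.

(** [Tr C = q^(-N) N_q], because the next skew-symmetrizer vanishes. *)
Lemma trace_C : q ^+ N * \tr C = qint q N.
Proof.
(* [N] also occurs in the types, hence the equation instead of a substitution. *)
have HN m : m = N -> \tr (skew m) = 1 /\ skew m.+1 = 0.
  by move=> ->; split=> //; exact: trace_skewN.
have [k Nk] : exists k, N = k.+1 by exists N.-1; rewrite prednK.
have [t1 s0] := HN k.+1 (esym Nk).
have := trace_skewS (1 : 'Op[F]_(N, k.+1)).
rewrite s0 mulr0 mxtrace0 mulr0 mul1r t1 mulr1 -Nk => /esym/eqP.
by rewrite subr_eq0 => /eqP.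
Qed.

(** The factor of [trace_skewS], once [Tr C] is known. *)
Lemma qint_diff n : (n <= N)%N ->
  q ^+ N * (q ^+ n * \tr C - qint q n) = qint q (N - n).
Proof.
move=> nN; rewrite mulrBr mulrCA trace_C.
have [m ->] : exists m, N = (m + n)%N by exists (N - n)%N; rewrite subnK.
rewrite addnK /qint !mulrA -mulrBl; congr (_ / _).
rewrite !mulrBr [q ^+ n * q ^+ (m + n)]mulrC opprB addrC addrA subrK.
rewrite exprD invfM mulfK ?expf_neq0 //; congr (_ - _).
by rewrite mulrCA mulfV ?expf_neq0 // mulr1.
Qed.

(** Both sides are products, so that no division by a [q]-integer is needed before the
    last step, where the two products agree up to the order of the factors. *)
Lemma qtrace_skew k : (k < N)%N ->
  q ^+ (N * k.+1) * \tr (Cprod k.+1 * skew k.+1) * \prod_(j < k.+1) qint q j.+1 =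
  \prod_(j < k.+1) qint q (N - j).
Proof.
elim: k => [|k IH] kN.
  rewrite !big_ord_recr !big_ord0 /= Cprod1 !mul1r mulr1 qint1 // mulr1 muln1.
  by rewrite trace_C subn0.
rewrite [in LHS]big_ord_recr [in RHS]big_ord_recr /= -(IH (ltnW kN)).
rewrite CprodS mulnS exprD -(qint_diff (ltnW kN)).
have := trace_skewS (Cprod k.+1).
move: (\tr _) (\tr (Cprod _ * _)) (\prod_(_ < _) _) => a b p e.
move: (q ^+ N) (q ^+ (N * k.+1)) (_ - _) e => x y c e.
transitivity (x * y * p * (qint q k.+2 * a)); first by rewrite /=; ring.
by rewrite e; ring.
Qed.

(** [Tr_R A^(N) = q^(-N^2)]. *)
Lemma qtrace_skewN : \tr (Cprod N * skew N) = q ^- (N ^ 2).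
Proof.
have H m : m = N -> q ^+ (N * m) * \tr (Cprod m * skew m) * \prod_(j < m) qint q j.+1 =
    \prod_(j < m) qint q (N - j).
  case: m => [e|k kN]; first by have := N0; rewrite -{1}e.
  by apply: qtrace_skew; rewrite -[X in (_ < X)%N]kN.
have := H N erefl.
have -> : \prod_(j < N) qint q (N - j) = \prod_(j < N) qint q j.+1.
  rewrite (reindex_inj rev_ord_inj); apply: eq_bigr => j _ /=.
  by rewrite subKn.
rewrite -[RHS]mul1r => /mulIf; rewrite -mulnn; move=> H'.
apply: (mulfI (expf_neq0 (N * N) q0)); rewrite H' ?mulfV ?expf_neq0 //.
by apply/prodf_neq0 => j _; exact: qn.
Qed.

End GLType.
End QuantumTrace.

(** * The quantum double *)

Section Assembly.
Variables (F : fieldType) (N : nat) (q : F) (R Psi : 'Op[F]_(N, 2)).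
Hypothesis HR : hecke_symmetry q R.
Hypothesis HPsi : skew_inverse R Psi.
Hypothesis qn : forall k, (0 < k)%N -> qint q k != 0.
Local Notation C := (qtrace_mx Psi).
Local Notation skew := (skew_symmetrizer q R).

Lemma Cprod_comm k j : (j.+1 < k.+1)%N ->
  act k.+1 j R * Cprod Psi k.+1 = Cprod Psi k.+1 * act k.+1 j R.
Proof.
move=> jk; pose x i := act k.+1 i C.
apply: (@commr_prod_pair _ x _ j k.+1) => // [i ik ij ij1|]; rewrite /x.
  move: ij; rewrite neq_ltn => /orP[ij|ij].
    by apply/esym/act_comm; rewrite ?addn1 ?addn2 // => *; rewrite mulrC.
  apply: act_comm; rewrite ?addn1 ?addn2 //; last by move=> *; rewrite mulrC.
  by rewrite ltn_neqAle eq_sym ij1.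
have E0 : act k.+1 j C = act k.+1 j (act 2 0 C) by rewrite act_act ?addn0 ?addn2.
have E1 : act k.+1 j.+1 C = act k.+1 j (act 2 1 C) by rewrite act_act ?addn1 ?addn2.
by rewrite E0 E1 -!actM ?addn2 // (qtrace_mx_comm HR HPsi).
Qed.

Lemma skew_Cprod k : skew k.+1 * Cprod Psi k.+1 = Cprod Psi k.+1 * skew k.+1.
Proof.
rewrite skew_asym; apply: asym_comm; first exact: scalar_mx_central.
by move=> i ik; apply: Cprod_comm.
Qed.

End Assembly.

Section OverRing.
Variables (F : fieldType) (Q : pzRingType) (sc : {rmorphism F -> Q}).
Hypothesis scC : central_scalars sc.

(** The scalar matrices with entries in the image of the ground field. *)
Definition sc_mx n (c : F) : 'M[Q]_n := (sc c)%:M.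
Fact sc_mx_zmod n : zmod_morphism (@sc_mx n).
Proof. by move=> x y; rewrite /sc_mx rmorphB raddfB. Qed.
Fact sc_mx_monoid n : monoid_morphism (@sc_mx n).
Proof. by split=> [|x y]; rewrite /sc_mx ?rmorph1 // rmorphM scalar_mxM. Qed.
HB.instance Definition _ n :=
  GRing.isZmodMorphism.Build F 'M[Q]_n (@sc_mx n) (@sc_mx_zmod n).
HB.instance Definition _ n :=
  GRing.isMonoidMorphism.Build F 'M[Q]_n (@sc_mx n) (@sc_mx_monoid n).

Lemma sc_mx_central n : central_scalars (@sc_mx n).
Proof.
move=> c X; rewrite /sc_mx -!mulmxE mul_scalar_mx; apply/matrixP=> i j.
rewrite !mxE (bigD1 j) //= mxE eqxx mulr1n big1 ?addr0 ?scC // => k kj.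
by rewrite mxE (negPf kj) mulr0.
Qed.

Lemma map_mx_mulC n (Y : 'M[F]_n) (t : Q) : map_mx sc Y * t%:M = t%:M * map_mx sc Y.
Proof.
rewrite -!mulmxE mul_scalar_mx; apply/matrixP=> i j.
rewrite !mxE (bigD1 j) //= !mxE eqxx mulr1n big1 ?addr0 ?scC // => k kj.
by rewrite !mxE (negPf kj) mulr0.
Qed.

Lemma mxtrace_map_mulC n (Y : 'M[F]_n) (X : 'M[Q]_n) :
  \tr (map_mx sc Y * X) = \tr (X * map_mx sc Y).
Proof.
rewrite -!mulmxE /mxtrace; under eq_bigr do rewrite mxE.
under [RHS]eq_bigr do rewrite mxE.
rewrite exchange_big; apply: eq_bigr => i _; apply: eq_bigr => j _.
by rewrite mxE scC.
Qed.

Variables (N : nat) (q : F) (R Psi : 'Op[F]_(N, 2)).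
Hypothesis HR : hecke_symmetry q R.
Hypothesis HPsi : skew_inverse R Psi.
Hypothesis qn : forall k, (0 < k)%N -> qint q k != 0.
Local Notation skew := (skew_symmetrizer q R).

Lemma entry_map_central k (Y : 'Op[F]_(N, k)) a b x :
  entry (map_mx sc Y) a b * x = x * entry (map_mx sc Y) a b.
Proof. by rewrite entry_map scC. Qed.

Lemma op1M (X Y : 'M[Q]_N) : op1 (X *m Y) = op1 X * op1 Y.
Proof.
apply: entryP => a b; rewrite -(w1K a) -(w1K b) -mulmxE entryM sum_w1 entryE !ffunE mxE.
by apply: eq_bigr => x _; rewrite !entryE !ffunE.
Qed.

Section Level.
Variable k : nat.
Local Notation r := (fun i => map_mx sc (act k.+1 i R)).
Local Notation ri := (fun i => map_mx sc (act k.+1 i (invmx R))).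
(** [X] acting in the first tensor factor. *)
Local Notation first X := (act k.+1 0 (op1 X) : 'Op[Q]_(N, k.+1)).

Lemma map_sc_mx n c : map_mx sc (c%:M : 'M[F]_n) = sc_mx n c.
Proof. exact: map_scalar_mx. Qed.

Lemma map_hecke : hecke_relations q (@sc_mx _) k.+1 r.
Proof.
have [Hh Hb Hf] := act_hecke HR k; split=> [i ik|i ik|i j ij jk].
- rewrite -!map_sc_mx -(rmorphB (map_mx sc)) -(rmorphD (map_mx sc)).
  by rewrite -(rmorphM (map_mx sc)) Hh // rmorph0.
- by rewrite -!(rmorphM (map_mx sc)) Hb.
- by rewrite -!(rmorphM (map_mx sc)) Hf.
Qed.

Lemma map_rK i : (i.+1 < k.+1)%N -> r i * ri i = 1.
Proof. by move=> ik; rewrite -(rmorphM (map_mx sc)) (proj1 (act_inv HR ik)) rmorph1. Qed.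

Lemma map_riK i : (i.+1 < k.+1)%N -> ri i * r i = 1.
Proof. by move=> ik; rewrite -(rmorphM (map_mx sc)) (proj2 (act_inv HR ik)) rmorph1. Qed.

Lemma map_skew : map_mx sc (skew k.+1) = asym q (@sc_mx _) r k.+1.
Proof.
rewrite skew_asym; apply: (@asym_morph _ q _ _ _ _ (map_mx sc)) => // c.
exact: map_sc_mx.
Qed.

Lemma copy_cp (X : 'M[Q]_N) i : (i < k.+1)%N -> copy sc R k.+1 X i = cp r ri (first X) i.
Proof.
by elim: i => [|i IH] ik //; rewrite cpS -IH 1?ltnW // -(act_invmx HR).
Qed.

Lemma first_legP X : first_leg k.+1 r (first X).
Proof.
move=> i i0 ik; rewrite map_act; apply/esym/act_comm; rewrite ?addn1 ?addn2 //.
by move=> *; rewrite entry_map_central.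
Qed.

Variables (M D : 'M[Q]_N).
Hypothesis HMM : rel_MM sc R M = 0.
Hypothesis HDD : rel_DD sc R D = 0.
Hypothesis HDM : rel_DM sc R M D = 0.

Lemma first_act2 X : (1 < k.+1)%N -> act k.+1 0 (act 2 0 (op1 X) : 'Op[Q]_(N, 2)) = first X.
Proof. by move=> k1; rewrite act_act. Qed.

Lemma first_MM : (1 < k.+1)%N ->
  r 0 * first M * r 0 * first M = first M * r 0 * first M * r 0.
Proof.
move=> k1; have /subr0_eq/(congr1 (act k.+1 0)) := HMM.
by rewrite !mulmxE !actM // !first_act2 // -!map_act.
Qed.

Lemma first_DD : (1 < k.+1)%N ->
  ri 0 * first D * ri 0 * first D = first D * ri 0 * first D * ri 0.
Proof.
move=> k1; have /subr0_eq/(congr1 (act k.+1 0)) := HDD.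
by rewrite !mulmxE !actM // !first_act2 // -!map_act.
Qed.

Lemma first_DM : (1 < k.+1)%N ->
  first D * r 0 * first M = r 0 * first M * ri 0 * first D * ri 0 + 1.
Proof.
move=> k1; have /subr0_eq/(congr1 (act k.+1 0)) := HDM.
by rewrite !mulmxE actD act_scalar // !actM // !first_act2 // -!map_act.
Qed.

Local Notation Aq := (map_mx sc (skew k.+1)).
Local Notation Mp := (\prod_(j < k.+1) copy sc R k.+1 M j).
Local Notation Dp := (\prod_(j < k.+1) copy sc R k.+1 D (rev_ord j)).

Let sC : central_scalars (@sc_mx #|{: word N k.+1}|) := @sc_mx_central _.
Let qq := hecke_qq HR.
Let q0 := hecke_q0 HR.

Lemma Mp_cp : Mp = Mprod r ri (first M) k.+1.
Proof. by apply: eq_bigr => j _; exact: copy_cp. Qed.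

Lemma Dp_cp : Dp = Dprod r ri (first D) k.+1.
Proof. by apply: eq_bigr => j _; exact: copy_cp. Qed.

Lemma skew_Mp : Aq * Mp = Mp * Aq.
Proof.
rewrite map_skew Mp_cp; apply: asym_comm => // i ik.
apply: (Mprod_comm map_hecke map_rK map_riK (first_legP M) first_MM) => //.
Qed.

Lemma skew_Dp : Aq * Dp = Dp * Aq.
Proof.
rewrite map_skew Dp_cp; apply: asym_comm => // i ik.
apply: (Dprod_comm map_hecke map_rK map_riK (first_legP D) first_DD) => //.
Qed.

(** The factorization applied to the skew-symmetrizer. *)
Lemma capelli_skew :
  \prod_(j < k.+1) (copy sc R k.+1 (M *m D) j + (sc (q ^+ j * qint q j))%:M) * Aq =
  sc_mx _ (q ^+ (k.+1 * k)) * (Mp * Dp * Aq).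
Proof.
have lA : absorbs_left q (@sc_mx _) k.+1 r Aq.
  by rewrite map_skew; case: (asym_absorbs qq qn sC map_hecke (leqnn _)).
have := capelli q0 qq sC map_hecke map_rK map_riK (first_legP M) (first_legP D)
  first_DD first_DM (leqnn _) lA.
rewrite -Mp_cp -Dp_cp => <-; congr (_ * _); apply: eq_bigr => j _.
by rewrite copy_cp // op1M actM.
Qed.

Hypothesis rk1 : \rank (skew k.+1) = 1%N.

Lemma map_skew_idem : Aq * Aq = Aq.
Proof. by rewrite -(rmorphM (map_mx sc)) /= skew_idem. Qed.

Lemma mxtrace_scalar n (t : Q) (X : 'M[Q]_n) : \tr (t%:M * X) = t * \tr X.
Proof. by rewrite -mulmxE mul_scalar_mx mxtraceZ. Qed.

(** Compressed by the rank-one [A], an operator that commutes with it becomes a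
    multiple of [A]. *)
Lemma skew_compress (X : 'Op[Q]_(N, k.+1)) : Aq * X = X * Aq ->
  Aq * X = (\tr (Aq * X))%:M * Aq.
Proof.
by move=> AX; rewrite -(rank1_sandwich scC _ rk1) -mulrA -AX mulrA map_skew_idem.
Qed.

Lemma qtrace_skew_prod (X : 'Op[Q]_(N, k.+1)) : Aq * X = X * Aq ->
  qtrace sc Psi (Aq *m X) =
  \tr (Aq * X) * sc (\tr (Cprod Psi k.+1 * skew k.+1)).
Proof.
move=> AX; rewrite /qtrace !mulmxE -/(Cprod Psi k.+1) {1}(skew_compress AX) mulrA.
rewrite map_mx_mulC // -mulrA mxtrace_scalar; congr (_ * _).
by rewrite -(rmorphM (map_mx sc)) trace_map_mx.
Qed.

Lemma skew_MpDp : Aq * (Mp * Dp) = Mp * Dp * Aq.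
Proof. by rewrite mulrA skew_Mp -!mulrA skew_Dp. Qed.

Lemma qtrace_capelli :
  qtrace sc Psi (Aq *m
    \prod_(j < k.+1) (copy sc R k.+1 (M *m D) j + (sc (q ^+ j * qint q j))%:M)) =
  sc (q ^+ (k.+1 * k)) * (\tr (Aq * Mp) * \tr (Aq * Dp) *
  sc (\tr (Cprod Psi k.+1 * skew k.+1))).
Proof.
have := capelli_skew; move: (\prod_(j < _) (_ + _)) => P PA.
have CA : map_mx sc (Cprod Psi k.+1) * Aq = Aq * map_mx sc (Cprod Psi k.+1).
  by rewrite -!(rmorphM (map_mx sc)) /= (skew_Cprod HR HPsi).
have -> : qtrace sc Psi (Aq *m P) =
    sc (q ^+ (k.+1 * k)) * qtrace sc Psi (Aq *m (Mp * Dp)).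
  rewrite /qtrace !mulmxE -/(Cprod Psi k.+1) -mxtrace_scalar.
  rewrite -{1}map_skew_idem -mulrA (mulrA (map_mx sc (Cprod _ _))) CA.
  rewrite -mulrA mxtrace_map_mulC -!mulrA PA; congr (\tr _).
  rewrite -skew_MpDp !mulrA -(sC _ (_ * Aq)) -!mulrA; congr (_ * (_ * _)).
  by rewrite !mulrA map_skew_idem.
rewrite (qtrace_skew_prod skew_MpDp).
have -> // : \tr (Aq * (Mp * Dp)) = \tr (Aq * Mp) * \tr (Aq * Dp).
by rewrite mulrA {1}(skew_compress skew_Mp) -mulrA mxtrace_scalar.
Qed.

End Level.

(** The identity over any ring in which the three relations hold. *)
Lemma qdet_capelli (M D : 'M[Q]_N) :
  rel_MM sc R M = 0 -> rel_DD sc R D = 0 -> rel_DM sc R M D = 0 ->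
  (0 < N)%N -> \rank (skew N) = 1%N -> skew N.+1 = 0 ->
  qtrace sc Psi (map_mx sc (skew N) *m
    \prod_(j < N) (copy sc R N (M *m D) j + (sc (q ^+ j * qint q j))%:M)) =
  sc (q ^- N) * qdet_M sc R Psi M q * qdet_D sc R Psi D q.
Proof.
move=> HMM HDD HDM N0 rk1 sk0; have q0 := hecke_q0 HR.
(* [N] also occurs in the types: the claim is generalized over the level [m]. *)
pose P m := \tr (Cprod Psi m * skew m) = q ^- (m ^ 2) -> \rank (skew m) = 1%N ->
  qtrace sc Psi (map_mx sc (skew m) *m
    \prod_(j < m) (copy sc R m (M *m D) j + (sc (q ^+ j * qint q j))%:M)) =
  sc (q ^- m) *
  (sc (q ^+ (m ^ 2)) * qtrace sc Psi (map_mx sc (skew m) *m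
     \prod_(j < m) copy sc R m M j)) *
  (sc (q ^+ (m ^ 2)) * qtrace sc Psi (map_mx sc (skew m) *m
     \prod_(j < m) copy sc R m D (rev_ord j))).
suff H m : (0 < m)%N -> P m.
  by apply: (H N N0) => //; apply: (qtrace_skewN HR HPsi qn).
case: m => // k _ tC rk.
rewrite (qtrace_capelli HMM HDD HDM rk) (qtrace_skew_prod rk (skew_Mp k HMM)).
rewrite (qtrace_skew_prod rk (skew_Dp k HDD)) tC.
move: (\tr _) (\tr _) => a b.
have qk x : sc (q ^+ (k.+1 ^ 2)) * (x * sc (q ^- (k.+1 ^ 2))) = x.
  by rewrite mulrA -(scC _ (_ * _)) mulrA -(rmorphM sc) mulVf ?expf_neq0 // rmorph1 mul1r.
rewrite !qk -!(scC _ (_ * _)) !mulrA -(rmorphM sc); congr (sc _ * _ * _).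
apply: (mulIf (expf_neq0 (k.+1 ^ 2) q0)); rewrite mulfVK ?expf_neq0 //.
by rewrite -mulnn mulnS exprD mulKf ?expf_neq0.
Qed.

End OverRing.

Section Relators.
Variables (F : fieldType) (A B : pzRingType) (p : {rmorphism A -> B}) (s : F -> A).
Variables (N : nat) (R : 'Op[F]_(N, 2)).

Lemma map_op1 (X : 'M[A]_N) : map_mx p (op1 X) = op1 (map_mx p X).
Proof. by apply: entryP => a b; rewrite entry_map !entryE mxE. Qed.

Lemma map_rel_MM (M : 'M[A]_N) :
  map_mx p (rel_MM s R M) = rel_MM (p \o s) R (map_mx p M).
Proof. by rewrite /rel_MM map_mxB !map_mxM !map_act !map_op1 !(map_mx_comp s p). Qed.

Lemma map_rel_DD (D : 'M[A]_N) :
  map_mx p (rel_DD s R D) = rel_DD (p \o s) R (map_mx p D).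
Proof. by rewrite /rel_DD map_mxB !map_mxM !map_act !map_op1 !(map_mx_comp s p). Qed.

Lemma map_rel_DM (M D : 'M[A]_N) :
  map_mx p (rel_DM s R M D) = rel_DM (p \o s) R (map_mx p M) (map_mx p D).
Proof.
by rewrite /rel_DM map_mxB map_mxD map_mx1 !map_mxM !map_act !map_op1 !(map_mx_comp s p).
Qed.

End Relators.

Section Final.
Variables (F : fieldType) (N : nat) (R : 'Op[F]_(N, 2)).
Local Notation free := (qd_free F N).
Local Notation proj := (tspi (qd_relator R)).

Fact qd_scal_zmod : zmod_morphism (qd_scal R).
Proof.
by move=> x y; rewrite /qd_scal -(rmorphB proj); congr tspi; apply: (rmorphB (@malgC _ F)).
Qed.
Fact qd_scal_monoid : monoid_morphism (qd_scal R).
Proof.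
split=> [|x y]; first exact: (rmorph1 proj).
rewrite /qd_scal -(rmorphM proj); congr tspi; apply: (rmorphM (@malgC _ F)).
Qed.
HB.instance Definition _ :=
  GRing.isZmodMorphism.Build F (qdouble R) (qd_scal R) qd_scal_zmod.
HB.instance Definition _ :=
  GRing.isMonoidMorphism.Build F (qdouble R) (qd_scal R) qd_scal_monoid.

Lemma qd_scal_central : central_scalars (qd_scal R).
Proof.
move=> c u; rewrite -[u]tspi_repr /qd_scal -!(rmorphM proj); congr tspi.
move: (repr u) => g; rewrite /qd_scal0 !malgM_def fgmulUg fgmulgU.
by apply: eq_bigr => k _; rewrite mul1m mulm1 mulrC.
Qed.

Lemma map_relator (X : 'Op[free]_(N, 2)) :
  (forall i j, qd_relator R (X i j)) -> map_mx proj X = 0.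
Proof.
move=> HX; apply/matrixP=> i j; rewrite !mxE -(rmorph0 proj).
by apply/tspiP; rewrite subr0; apply/tsideal_gen/HX.
Qed.

Lemma qd_MM : rel_MM (qd_scal R) R (qd_M R) = 0.
Proof.
rewrite -[LHS](map_rel_MM proj) map_relator // => i j.
by exists i, j; constructor 1; reflexivity.
Qed.

Lemma qd_DD : rel_DD (qd_scal R) R (qd_D R) = 0.
Proof.
rewrite -[LHS](map_rel_DD proj) map_relator // => i j.
by exists i, j; constructor 2; reflexivity.
Qed.

Lemma qd_DM : rel_DM (qd_scal R) R (qd_M R) (qd_D R) = 0.
Proof.
rewrite -[LHS](map_rel_DM proj) map_relator // => i j.
by exists i, j; constructor 3; reflexivity.
Qed.

End Final.

Theorem corollary6 (K : realType) (N : nat) (q : K[i]) (R Psi : 'Op[K[i]]_(N, 2)) :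
  (1 <= N)%N ->
  (forall k : nat, (1 <= k)%N -> qint q k != 0) ->
  GL_type q R ->
  skew_inverse R Psi ->
  let sc := qd_scal R in
  let M := qd_M R in
  let D := qd_D R in
  let L := M *m D in
  qtrace sc Psi
    (map_mx sc (skew_symmetrizer q R N) *m
     \prod_(j < N) (copy sc R N L j + (sc (q ^+ j * qint q j))%:M))
  = sc (q ^- N) * qdet_M sc R Psi M q * qdet_D sc R Psi D q.
Proof.
move=> N1 qn [HR _ rk1 sk0] HPsi sc M D L.
exact: (qdet_capelli (@qd_scal_central _ N R) HR HPsi qn (qd_MM R) (qd_DD R) (qd_DM R)).
Qed.
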